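(* Let $T$ be a competitive map on a rectangular region $\mathcal{R}\subset\mathbb{R}^2$. Let $\overline{\mathrm{x}}\in\mathcal{R}$ be a fixed point of $T$ such that $\Delta:=\mathcal{R}\cap \mathrm{int}\,(\mathcal{Q}_1(\overline{\mathrm{x}})\cup\mathcal{Q}_3(\overline{\mathrm{x}}))$ is nonempty (i.e., $\overline{\mathrm{x}}$ is not the NW or SE vertex of $\mathcal{R}$), and $T$ is strongly competitive on $\Delta$. Suppose that $T$ has a $C^1$ extension to a neighborhood of $\overline{\mathrm{x}}$, and that the Jacobian $J_T(\overline{\mathrm{x}})$ of $T$ at $\overline{\mathrm{x}}$ has real eigenvalues $\lambda,\mu$ such that $0<|\lambda|<\mu$, where $|\lambda|<1$, and the eigenspace $E^\lambda$ associated with $\lambda$ is not a coordinate axis. Suppose further that there exists a neighborhood $\mathcal{U}$ of $\overline{\mathrm{x}}$ in $\mathbb{R}^2$ such that $T$ is of class $C^k$ on $\mathcal{U}\cup\Delta$ for some $k\ge 1$, and that the Jacobian of $T$ at each $\mathrm{x}\in\Delta$ is invertible. Then the curve $\mathcal{C}$ given by the invariant curve theorem recalled in the context is of class $C^k$.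
   Context: A region $\mathcal{R}\subset\mathbb{R}^2$ is rectangular if it is the cartesian product of two intervals in $\mathbb{R}$. A map on $\mathcal{R}$ is a continuous function $T:\mathcal{R}\to\mathcal{R}$; write $T=(f,g)$. $T$ is competitive if $f(x,y)$ is non-decreasing in $x$ and non-increasing in $y$, and $g(x,y)$ is non-increasing in $x$ and non-decreasing in $y$. It is strongly competitive (on a set) if $f$ and $g$ are coordinate-wise strictly monotone in this sense (on that set). For $(x,y)\in\mathbb{R}^2$: $\mathcal{Q}_1(x,y)=\{(u,v):u\ge x,\ v\ge y\}$, $\mathcal{Q}_3(x,y)=\{(u,v):u\le x,\ v\le y\}$; $\mathrm{int}$ denotes interior. A set $\mathcal{A}$ is invariant if $T(\mathcal{A})\subset\mathcal{A}$. The basin of attraction of $\overline{\mathrm{x}}$ is the set of all $\mathrm{y}\in\mathcal{R}$ with $T^n(\mathrm{y})\to\overline{\mathrm{x}}$. A minimal period-two point is a point $\mathrm{x}$ with $T^2(\mathrm{x})=\mathrm{x}\neq T(\mathrm{x})$. Invariant curve theorem: under the hypotheses of the claim other than the $C^k$ and invertibility assumptions (that is, those up to and including the condition on $E^\lambda$), there exists a curve $\mathcal{C}\subset\mathcal{R}$ through $\overline{\mathrm{x}}$ that is invariant and a subset of the basin of attraction of $\overline{\mathrm{x}}$, such that $\mathcal{C}$ is tangential to the eigenspace $E^\lambda$ at $\overline{\mathrm{x}}$, and $\mathcal{C}$ is the graph of a strictly increasing continuous function of the first coordinate on an interval. Any endpoints of $\mathcal{C}$ in the interior of $\mathcal{R}$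 are either fixed points or minimal period-two points; in the latter case, the set of endpoints of $\mathcal{C}$ is a minimal period-two orbit of $T$. The curve $\mathcal{C}$ of the claim is the curve in the conclusion of this theorem. *)

(* Defs.v *)
From HB Require Import structures.
From mathcomp Require Import all_boot all_order all_algebra.
From mathcomp Require Import all_classical all_reals all_analysis.

Set Implicit Arguments.
Unset Strict Implicit.
Unset Printing Implicit Defensive.
Import Order.TTheory GRing.Theory Num.Theory.
Import numFieldNormedType.Exports.

Local Open Scope classical_set_scope.
Local Open Scope ring_scope.

Notation plane R := 'rV[R]_2.

(* The abscissa of p is p 0 0, its ordinate p 0 1. *)
Definition pt {R : realType} (x y : R) : plane R :=
  \row_(i < 2) (if i == 0 then x else y).

Section Smoothness.
Context {R : realType} {V W : normedModType R}.

(* For an open set O of a finite-dimensional V: all iterated directional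
   derivatives of order at most k exist and are continuous on O. *)
Fixpoint Ck_open (k : nat) (O : set V) (f : V -> W) : Prop :=
  match k with
  | 0%N => forall p, O p -> {for p, continuous f}
  | k'.+1 => (forall p, O p -> differentiable f p) /\
             (forall v, Ck_open k' O ('D_v f))
  end.

(* F is a C^k extension, to a neighborhood of p, of f restricted to D. *)
Definition Ck_extension (k : nat) (D : set V) (f : V -> W) (p : V)
    (F : V -> W) : Prop :=
  exists O : set V, [/\ open_nbhs p O, Ck_open k O F &
    forall q, O q -> D q -> F q = f q].

(* A function given on an arbitrary set D is of class C^k at a point when it
   has a C^k extension to a neighborhood of that point; only the values of f
   on D matter. *)
Definition class_Ck (k : nat) (D : set V) (f : V -> W) (A : set V) : Prop :=
  forall p, A p -> exists F, Ck_extension k D f p F.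

End Smoothness.

Section CompetitiveMaps.
Context {R : realType}.
Implicit Types (D C : set (plane R)) (T : plane R -> plane R) (p e : plane R).

Definition rectangle (I1 I2 : interval R) : set (plane R) :=
  [set p | p 0 0 \in I1 /\ p 0 1 \in I2].

(* Maps are total functions; their values outside the region are irrelevant. *)
Definition region_map D T : Prop :=
  {within D, continuous T} /\ forall p, D p -> D (T p).

Definition competitive_on D T : Prop :=
  (forall x x' y, D (pt x y) -> D (pt x' y) -> x <= x' ->
     T (pt x y) 0 0 <= T (pt x' y) 0 0 /\ T (pt x' y) 0 1 <= T (pt x y) 0 1) /\
  (forall x y y', D (pt x y) -> D (pt x y') -> y <= y' ->
     T (pt x y') 0 0 <= T (pt x y) 0 0 /\ T (pt x y) 0 1 <= T (pt x y') 0 1).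

Definition strongly_competitive_on D T : Prop :=
  (forall x x' y, D (pt x y) -> D (pt x' y) -> x < x' ->
     T (pt x y) 0 0 < T (pt x' y) 0 0 /\ T (pt x' y) 0 1 < T (pt x y) 0 1) /\
  (forall x y y', D (pt x y) -> D (pt x y') -> y < y' ->
     T (pt x y') 0 0 < T (pt x y) 0 0 /\ T (pt x y) 0 1 < T (pt x y') 0 1).

Definition Q1 p : set (plane R) := [set q | p 0 0 <= q 0 0 /\ p 0 1 <= q 0 1].
Definition Q3 p : set (plane R) := [set q | q 0 0 <= p 0 0 /\ q 0 1 <= p 0 1].

Definition Delta D p : set (plane R) := D `&` interior (Q1 p `|` Q3 p).

Definition basin D T p : set (plane R) :=
  [set q | D q /\ (fun n => iter n T q) @ \oo --> p].

Definition minimal_period_two T p : Prop := T (T p) = p /\ T p <> p.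

Definition graph (I : interval R) (phi : R -> R) : set (plane R) :=
  [set p | p 0 0 \in I /\ p 0 1 = phi (p 0 0)].

(* Endpoints need not belong to the curve. *)
Definition graph_endpoints (I : interval R) (phi : R -> R) : set (plane R) :=
  [set e | closure (graph I phi) e /\
     (lbound [set` I] (e 0 0) \/ ubound [set` I] (e 0 0))].

(* The secants of C through p approach the row space of E as q tends to p
   along C. *)
Definition tangential C (E : 'M[R]_2) p : Prop :=
  forall eps : R, 0 < eps -> \forall q \near p, C q ->
    exists2 v : plane R, (v <= E)%MS & `|q - p - v| <= eps * `|q - p|.

Record invariant_curve D T p (E : 'M[R]_2) (I : interval R) (phi : R -> R) :
    Prop := InvariantCurve {
  curve_nondegenerate : exists a b, [/\ a \in I, b \in I & a < b];
  curve_continuous : {within [set` I], continuous phi};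
  curve_increasing : {in I &, {homo phi : x y / x < y}};
  curve_sub : graph I phi `<=` D;
  curve_through : graph I phi p;
  curve_invariant : forall q, graph I phi q -> graph I phi (T q);
  curve_basin : graph I phi `<=` basin D T p;
  curve_tangential : tangential (graph I phi) E p;
  curve_endpoints : forall e, graph_endpoints I phi e -> interior D e ->
    T e = e \/
    (minimal_period_two T e /\ graph_endpoints I phi = [set e; T e])
}.

End CompetitiveMaps.

(* Main.v *)
(* Near the fixed point (c, phi c), write h for the first coordinate of T along
   the curve, so that T (x, phi x) = (h x, phi (h x)).  The tangency of C forces
   any two points of C close to the fixed point to span a slope close to that
   of E^lam: otherwise their difference would be expanded at a rate close to
   mu, while both orbits converge at a rate close to |lam|.  The slope of a pair
   of points of C is then determined by the slope of the image pair through a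
   map with contraction factor close to |lam| / mu, so slopes cannot oscillate
   and phi is C^1.  Its derivative solves w(x) = M(x, w(h x)), where M is
   determined by the Jacobian of T along C, and differentiating such an equation
   gives one of the same kind with a better contraction factor; hence phi is
   C^k near c.  At any other point p of C some T^n p is close to the fixed
   point, and near p the curve satisfies K(x, phi x) = 0 with K obtained by
   composing T^n with v - phi u.  As T is competitive and its Jacobians are
   invertible along C, the derivative of T^n maps (0, 1) to a nonzero vector
   pointing north-west, whereas phi' > 0 near c; therefore the derivative of K
   along (0, 1) does not vanish. *)

Require Import Defs.
From HB Require Import structures.
From mathcomp Require Import all_boot all_order all_algebra.
From mathcomp Require Import all_classical all_reals all_analysis.
From mathcomp Require Import ring lra.

Set Implicit Arguments.
Unset Strict Implicit.
Unset Printing Implicit Defensive.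
Import Order.TTheory GRing.Theory Num.Theory.
Import numFieldNormedType.Exports.

Local Open Scope classical_set_scope.
Local Open Scope ring_scope.

(** * Calculus of C^k maps *)

Section DifferentiabilityEstimates.
Context {R : realType}.
Implicit Types V W X : normedModType R.

(** The fixed point may lie on the boundary of the rectangle or at an end of the curve, and
    smoothness is given by local extensions. The invariance equations therefore hold on [I] only:
    derivatives are taken within [I], where two formulas for the same derivative must agree because
    [I] accumulates at each of its points. An extension of the curve function is recovered as a
    primitive of an extension of its derivative. The curve is given, so no fixed point problem is
    solved. Its chords are estimated instead, with both end points moving; the limit of the slopes
    over such pairs is a strict derivative, and its existence and continuity come together.
    Differentiating the equation of the curve produces a derivative known only to be continuous.
    Hence the C^1 criterion for [u(x) = N(x, u(h x))] has to start from a continuous [u] and reach a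
    Lipschitz bound on its own. The Jacobian at the fixed point belongs to a C^1 extension of [T],
    while the class C^k is carried by another one; only their partial derivatives at that point can
    be compared. *)

Lemma nearP V (p : V) (P : V -> Prop) :
  (\forall q \near p, P q) <->
  exists2 d : R, 0 < d & forall q, `|q - p| < d -> P q.
Proof.
split=> [/nbhs_normP[d /= d0 H]|[d d0 H]].
  by exists d => // q qp; apply: H; rewrite /ball_ /= distrC.
by apply/nbhs_normP; exists d => // q; rewrite /ball_ /= distrC; exact: H.
Qed.

Lemma differentiable_approx V W (f : V -> W) (p : V) (eps : R) :
  differentiable f p -> 0 < eps ->
  \forall q \near p, `|f q - f p - 'd f p (q - p)| <= eps * `|q - p|.
Proof.
move=> /diff_locallyP[_ /eqaddoP h] e0.
have /= := h _ e0; rewrite !near_simpl => H.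
rewrite (near_shift 0 p); near=> q => /=.
rewrite subr0 addrK -addrA -opprD.
by near: q; move: H; apply: filterS => q /= ; rewrite ?subr0 .
Unshelve. all: by end_near. Qed.

Lemma approx_differentiable V W (f : V -> W) (L : {linear V -> W}) (p : V) :
  continuous L ->
  (forall eps, 0 < eps ->
   \forall q \near p, `|f q - f p - L (q - p)| <= eps * `|q - p|) ->
  differentiable f p /\ 'd f p = L :> (V -> W).
Proof.
move=> cL h.
have E : f \o shift p = cst (f p) + L +o_ 0 id.
  apply/eqaddoP => eps e0; have := h _ e0.
  rewrite (near_shift 0 p) !near_simpl /=; apply: filterS => q /=.
  by rewrite subr0 addrK -addrA -opprD.
have dE := diff_unique cL E; split=> //.
by apply/diff_locallyP; rewrite dE; split.
Qed.

Lemma near_eq_differentiable V W (f g : V -> W) (p : V) :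
  (\forall q \near p, f q = g q) -> differentiable f p -> differentiable g p.
Proof.
move=> fg df; have cd := diff_continuous df.
have fgp := nbhs_singleton fg.
apply: (proj1 (approx_differentiable (L := 'd f p) cd _)) => e e0.
have := differentiable_approx df e0.
by apply: filterS2 fg => q <-; rewrite fgp.
Qed.

Lemma continuous_dist_lt V W (f : V -> W) (p : V) (e : R) :
  {for p, continuous f} -> 0 < e -> \forall q \near p, `|f p - f q| < e.
Proof. by move=> cf e0; apply: cvgr_dist_lt. Qed.

End DifferentiabilityEstimates.

Section CkCalculus.
Context {R : realType}.
Implicit Types V W X : normedModType R.

Lemma near_eq_continuous V W (f g : V -> W) (p : V) :
  (\forall q \near p, f q = g q) ->
  {for p, continuous f} -> {for p, continuous g}.
Proof.
move=> fg; rewrite /prop_for /continuous_at -(nbhs_singleton fg).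
by apply: cvg_trans; apply: near_eq_cvg; apply: filterS fg => q ->.
Qed.

Lemma open_near V (O : set V) p : open O -> O p -> \forall q \near p, O q.
Proof. by move=> oO Op; exact: open_nbhs_nbhs. Qed.

Lemma Ck_open_eq V W k (O : set V) (f g : V -> W) : open O ->
  (forall p, O p -> f p = g p) -> Ck_open k O f -> Ck_open k O g.
Proof.
move=> oO; elim: k f g => [|k IH] f g fg /=.
  move=> cf p Op; apply: near_eq_continuous (cf p Op).
  exact: filterS (open_near oO Op).
move=> [df Df]; split=> [p Op|v].
  apply: near_eq_differentiable (df p Op).
  exact: filterS (open_near oO Op).
apply: IH (Df v) => p Op; apply: near_eq_derive.
exact: filterS (open_near oO Op).
Qed.

Lemma Ck_open_sub V W k (O O' : set V) (f : V -> W) :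
  O' `<=` O -> Ck_open k O f -> Ck_open k O' f.
Proof.
move=> sO; elim: k f => [|k IH] f /=; first by move=> cf p /sO /cf.
by move=> [df Df]; split=> [p /sO /df//|v]; exact: IH (Df v).
Qed.

Lemma Ck_openS V W k (O : set V) (f : V -> W) :
  Ck_open k.+1 O f -> Ck_open k O f.
Proof.
elim: k f => [|k IH] f [df Df].
  by move=> p /df /differentiable_continuous.
by split=> // v; exact: IH (Df v).
Qed.

Lemma Ck_open_le V W j k (O : set V) (f : V -> W) : (j <= k)%N ->
  Ck_open k O f -> Ck_open j O f.
Proof.
move=> /subnK <-; elim: (k - j)%N => [//|n IH].
by rewrite addSn => /Ck_openS.
Qed.

Lemma Ck_open0 V W k (O : set V) (f : V -> W) :
  Ck_open k O f -> forall p, O p -> {for p, continuous f}.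
Proof. exact: (@Ck_open_le _ _ 0). Qed.

Lemma Ck_open_cst V W k (O : set V) (w : W) : open O ->
  Ck_open k O (fun=> w).
Proof.
move=> oO; elim: k w => [|k IH] w /=; first by move=> p _; exact: cvg_cst.
split=> [p _|v]; first exact: differentiable_cst.
apply: Ck_open_eq oO _ (IH 0) => p _.
by rewrite derive_cst.
Qed.

Lemma Ck_open_lin V W k (O : set V) (f : {linear V -> W}) : open O ->
  continuous f -> Ck_open k O f.
Proof.
move=> oO cf; case: k => [|k] /=; first by move=> p _; exact: cf.
split=> [p _|v]; first exact: linear_differentiable.
apply: Ck_open_eq oO _ (Ck_open_cst k (f v) oO) => p _.
by rewrite deriveE ?diff_lin//; exact: linear_differentiable.
Qed.

Lemma Ck_openD V W k (O : set V) (f g : V -> W) : open O ->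
  Ck_open k O f -> Ck_open k O g -> Ck_open k O (fun p => f p + g p).
Proof.
move=> oO; elim: k f g => [|k IH] f g /=.
  by move=> cf cg p Op; apply: cvgD; [exact: cf|exact: cg].
move=> [df Df] [dg Dg]; split=> [p Op|v].
  by apply: differentiableD; [exact: df|exact: dg].
apply: Ck_open_eq oO _ (IH _ _ (Df v) (Dg v)) => p Op.
by rewrite deriveD//; apply: diff_derivable; [exact: df|exact: dg].
Qed.

Lemma derive_linear_comp V W X (L : {linear W -> X}) (f : V -> W) p v :
  continuous L -> differentiable f p -> 'D_v (L \o f) p = L ('D_v f p).
Proof.
move=> cL df; have dL : differentiable L (f p) by exact: linear_differentiable.
by rewrite !deriveE//; [rewrite diff_comp// diff_lin|exact: differentiable_comp].
Qed.

Lemma Ck_open_postlin V W X k (O : set V) (L : {linear W -> X}) (f : V -> W) :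
  open O -> continuous L -> Ck_open k O f -> Ck_open k O (L \o f).
Proof.
move=> oO cL; elim: k f => [|k IH] f /=.
  by move=> cf p Op; apply: continuous_comp; [exact: cf|exact: cL].
move=> [df Df]; split=> [p Op|v].
  by apply: differentiable_comp; [exact: df|exact: linear_differentiable].
apply: Ck_open_eq oO _ (IH _ (Df v)) => p Op /=.
by rewrite derive_linear_comp//; exact: df.
Qed.

Lemma Ck_openM V k (O : set V) (f g : V -> R) : open O ->
  Ck_open k O f -> Ck_open k O g -> Ck_open k O (fun p => f p * g p).
Proof.
move=> oO; elim: k f g => [|k IH] f g /=.
  by move=> cf cg p Op; apply: cvgM; [exact: cf|exact: cg].
move=> Cf Cg; have [[df Df] [dg Dg]] := (Cf, Cg); split=> [p Op|v].
  by apply: differentiableM; [exact: df|exact: dg].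
have Cf' := Ck_openS (k:=k) Cf; have Cg' := Ck_openS (k:=k) Cg.
apply: Ck_open_eq oO _
  (Ck_openD oO (IH _ _ Cf' (Dg v)) (IH _ _ Cg' (Df v))) => p Op.
by rewrite deriveM//; apply: diff_derivable; [exact: df|exact: dg].
Qed.

Lemma Ck_openN V k (O : set V) (f : V -> R) : open O ->
  Ck_open k O f -> Ck_open k O (fun p => - f p).
Proof.
move=> oO Cf; apply: Ck_open_eq oO _
  (Ck_openM oO (Ck_open_cst k (-1 : R) oO) Cf) => p _.
by rewrite mulN1r.
Qed.

Lemma Ck_openV V k (O : set V) (f : V -> R) : open O ->
  (forall p, O p -> f p != 0) ->
  Ck_open k O f -> Ck_open k O (fun p => (f p)^-1).
Proof.
move=> oO f0; elim: k f f0 => [|k IH] f f0 /=.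
  by move=> cf p Op; apply: cvgV; [exact: f0|exact: cf].
move=> Cf; have [df Df] := Cf; split=> [p Op|v].
  by apply: differentiableV; [exact: df|exact: f0].
have Ci := IH _ f0 (Ck_openS (k:=k) Cf).
apply: Ck_open_eq oO _
  (Ck_openN oO (Ck_openM oO (Ck_openM oO Ci Ci) (Df v))) => p Op.
rewrite deriveV ?f0//; last by apply: diff_derivable; exact: df.
by rewrite -expr2 exprVn -mulNr.
Qed.

(* In dimension one, e1 = 0. *)
Definition frame V (e0 e1 : V) (c0 c1 : {linear V -> R}) : Prop :=
  [/\ continuous c0, continuous c1 & forall v, v = c0 v *: e0 + c1 v *: e1].

Lemma derive_frame V W (e0 e1 : V) (c0 c1 : {linear V -> R}) (f : V -> W) p v :
  frame e0 e1 c0 c1 -> differentiable f p ->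
  'D_v f p = c0 v *: 'D_e0 f p + c1 v *: 'D_e1 f p.
Proof.
move=> [_ _ vE] df; rewrite !deriveE// [in LHS](vE v).
by rewrite linearD !linearZ.
Qed.

(** The chain rule differentiates [g] in the direction ['D_v f p], which moves with [p]. Expanding
    that direction in the frame leaves derivatives of [g] along the fixed vectors [e0], [e1],
    composed with [f], to which the induction applies. *)
Lemma Ck_open_comp V W (e0 e1 : W) (c0 c1 : {linear W -> R}) k
    (O : set V) (O' : set W) (f : V -> W) (g : W -> R) :
  frame e0 e1 c0 c1 -> open O -> (forall p, O p -> O' (f p)) ->
  Ck_open k O f -> Ck_open k O' g -> Ck_open k O (g \o f).
Proof.
move=> fr oO sO; have [cc0 cc1 _] := fr.
elim: k f g sO => [|k IH] f g sO /=.
  move=> cf cg p Op; apply: continuous_comp; first exact: cf.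
  exact/cg/sO.
move=> Cf Cg; have [[df Df] [dg Dg]] := (Cf, Cg); split=> [p Op|v].
  by apply: differentiable_comp; [exact: df|exact/dg/sO].
have Cf' := Ck_openS (k:=k) Cf.
have C0 := Ck_openM oO (Ck_open_postlin oO cc0 (Df v))
  (IH _ _ sO Cf' (Dg e0)).
have C1 := Ck_openM oO (Ck_open_postlin oO cc1 (Df v))
  (IH _ _ sO Cf' (Dg e1)).
apply: Ck_open_eq oO _ (Ck_openD oO C0 C1) => p Op /=.
have dgf : differentiable g (f p) by exact/dg/sO.
have dfp := df p Op.
rewrite [RHS]deriveE; last exact: differentiable_comp.
rewrite diff_comp//= -(deriveE _ dfp) -(deriveE _ dgf).
by rewrite [RHS](derive_frame _ fr dgf).
Qed.

End CkCalculus.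

Section Line.
Context {R : realType} {V : normedModType R}.

Definition line (e : V) (x : R) : V := x *: e.

Fact line_is_linear e : linear (line e).
Proof. by move=> a u v; rewrite /line scalerDl scalerA. Qed.

HB.instance Definition _ e :=
  GRing.isLinear.Build R R V *:%R (line e) (line_is_linear e).

Lemma line_continuous e : continuous (line e).
Proof. by move=> x; exact: scalel_continuous. Qed.

End Line.

Section PlaneCalculus.
Context {R : realType}.
Implicit Types (p q : plane R).

Lemma pt0 (x y : R) : pt x y 0 0 = x.
Proof. by rewrite mxE. Qed.

Lemma pt1 (x y : R) : pt x y 0 1 = y.
Proof. by rewrite mxE. Qed.

Lemma plane_eqP p q : p 0 0 = q 0 0 -> p 0 1 = q 0 1 -> p = q.
Proof.
move=> e0 e1; apply/rowP => i.
by case: (unliftP 0 i) => [j|] ->//; rewrite ord1 (_ : lift _ _ = 1)//; apply/val_inj.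
Qed.

Lemma pt_eta p : pt (p 0 0) (p 0 1) = p.
Proof. by apply: plane_eqP; rewrite ?pt0 ?pt1. Qed.

Lemma ptB (x y x' y' : R) : pt x y - pt x' y' = pt (x - x') (y - y').
Proof. by apply: plane_eqP; rewrite !mxE. Qed.

Lemma normr_coord p i : `|p 0 i| <= `|p|.
Proof.
rewrite /Num.norm /= mx_normrE.
exact: (le_bigmax _ (fun ij => `|p ij.1 ij.2|) (0, i)).
Qed.

Lemma plane_norm_le p : `|p| <= `|p 0 0| + `|p 0 1|.
Proof.
rewrite {1}/Num.norm /= mx_normrE; apply/bigmax_leP; split=> [|[i j] _ /=].
  exact: addr_ge0.
rewrite ord1; case: (unliftP 0 j) => [k|] ->; last by rewrite lerDl.
by rewrite ord1 (_ : lift _ _ = 1) ?lerDr//; apply/val_inj.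
Qed.

Lemma plane_norm_lt p (d : R) : `|p 0 0| < d -> `|p 0 1| < d -> `|p| < d.
Proof.
move=> h0 h1; rewrite {1}/Num.norm /= mx_normrE.
apply/bigmax_ltP; split=> [|[i j] _ /=]; first exact: le_lt_trans h0.
rewrite ord1; case: (unliftP 0 j) => [k|] ->//.
by rewrite ord1 (_ : lift _ _ = 1)//; apply/val_inj.
Qed.

Definition coordinate (i : 'I_2) (p : plane R) : R := p 0 i.

Fact coordinate_is_linear i : linear (coordinate i).
Proof. by move=> a u v; rewrite /coordinate !mxE. Qed.

HB.instance Definition _ i :=
  GRing.isLinear.Build R (plane R) R *:%R (coordinate i) (coordinate_is_linear i).

Lemma coordinate_continuous i : continuous (coordinate i).
Proof. exact: coord_continuous. Qed.

Lemma ptE (x y : R) : pt x y = line (pt 1 0) x + line (pt 0 1) y.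
Proof. by apply: plane_eqP; rewrite !mxE /=; ring. Qed.

Lemma plane_frame : frame (pt 1 0) (pt 0 1) (coordinate 0) (coordinate 1).
Proof.
split; [exact: coordinate_continuous..|move=> v].
by rewrite -[LHS]pt_eta ptE.
Qed.

Lemma line_frame : frame (1 : R) (0 : R) idfun idfun.
Proof.
split; [by move=> x; exact: cvg_id..|move=> v].
by rewrite /= scaler0 addr0 [RHS]mulr1.
Qed.

Lemma Ck_open_pt (V : normedModType R) k (O : set V) (a b : V -> R) : open O ->
  Ck_open k O a -> Ck_open k O b -> Ck_open k O (fun v => pt (a v) (b v)).
Proof.
move=> oO Ca Cb; apply: Ck_open_eq oO _
  (Ck_openD oO (Ck_open_postlin oO (@line_continuous _ _ (pt 1 0)) Ca)
     (Ck_open_postlin oO (@line_continuous _ _ (pt 0 1)) Cb)) => p _.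
by rewrite [RHS]ptE.
Qed.

Lemma Ck_open_coord (V : normedModType R) k (O : set V) (f : V -> plane R) i :
  open O -> Ck_open k O f -> Ck_open k O (fun v => f v 0 i).
Proof. by move=> oO; exact: (Ck_open_postlin oO (@coordinate_continuous i)). Qed.

End PlaneCalculus.

(** * Linear approximation of increments, uniform over pairs of points *)

Section StrictDifferentiability.
Context {R : realType}.
Implicit Types V : normedModType R.

Lemma is_derive_segment V (f : V -> R) (q w : V) (t : R) :
  derivable f (q + t *: w) w ->
  is_derive t (1 : R) (fun t : R => f (q + t *: w)) ('D_w f (q + t *: w)).
Proof.
have E : (fun h : R => h^-1 *: (((fun t : R => f (q + t *: w)) \o shift t)
    (h *: (1 : R)) - f (q + t *: w))) =
  (fun h => h^-1 *: ((f \o shift (q + t *: w)) (h *: w) - f (q + t *: w))).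
  apply/funext => h /=; congr (_ *: (f _ - _)).
  by rewrite [h *: (1 : R)]mulr1 scalerDl addrCA.
by move=> df; split; rewrite /derivable /derive E.
Qed.

(** Both end points move while the derivative stays at [p], as the comparison of chords requires.
    The mean value theorem on the segment gives the derivative at an intermediate point, and
    continuity of the two frame derivatives brings it back to [p]; each of them is charged
    [eps / 2]. *)
Lemma strict_approx V (e0 e1 : V) (c0 c1 : {linear V -> R}) (O : set V)
    (f : V -> R) (p : V) (eps : R) :
  frame e0 e1 c0 c1 ->
  (forall v, `|c0 v| <= `|v|) -> (forall v, `|c1 v| <= `|v|) ->
  open O -> Ck_open 1 O f -> O p -> 0 < eps ->
  exists2 d : R, 0 < d & forall q q', `|q - p| < d -> `|q' - p| < d ->
    `|f q' - f q - 'D_(q' - q) f p| <= eps * `|q' - q|.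
Proof.
move=> fr n0 n1 oO [df Df] Op eps0.
have e20 : 0 < eps / 2 by lra.
have c0p := Df e0 p Op; have c1p := Df e1 p Op.
have H : \forall q \near p, [/\ O q, `|'D_e0 f q - 'D_e0 f p| < eps / 2 &
    `|'D_e1 f q - 'D_e1 f p| < eps / 2].
  apply: filterS3 (open_near oO Op) (continuous_dist_lt c0p e20)
    (continuous_dist_lt c1p e20) => q Oq k0 k1.
  by split; [exact Oq|rewrite distrC; exact k0|rewrite distrC; exact k1].
have [d d0 {}H] := (nearP _ _).1 H.
exists d => // q q' qp q'p; set w := q' - q.
pose a t : V := q + t *: w.
have aB t : 0 <= t <= 1 -> `|a t - p| < d.
  move=> /andP[t0 t1].
  have -> : a t - p = (1 - t) *: (q - p) + t *: (q' - p).
    rewrite scalerBl scale1r -[RHS]addrA [X in _ = _ + X]addrC -scalerBr.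
    rewrite opprB addrA subrK -/w.
    by rewrite addrAC.
  apply: le_lt_trans (ler_normD _ _) _; rewrite !normrZ ger0_norm ?subr_ge0//.
  rewrite (ger0_norm t0).
  have [AB|/ltW AB] := leP `|q - p| `|q' - p|.
    apply: le_lt_trans q'p; rewrite -subr_ge0.
    by rewrite [leRHS](_ : _ = (1 - t) * (`|q' - p| - `|q - p|));
      [apply: mulr_ge0; rewrite subr_ge0|ring].
  apply: le_lt_trans qp; rewrite -subr_ge0.
  by rewrite [leRHS](_ : _ = t * (`|q - p| - `|q' - p|));
    [apply: mulr_ge0; rewrite ?subr_ge0|ring].
pose g t := f (a t).
have gd (t : R) : t \in `]0, 1[ -> is_derive t (1 : R) g ('D_w f (a t)).
  rewrite in_itv /= => /andP[t0 t1].
  have /aB /H[Oa _ _] : 0 <= t <= 1 by rewrite !ltW.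
  by apply: is_derive_segment; apply: diff_derivable; exact: df.
have gc : {within `[0, 1], continuous g}.
  apply: derivable_within_continuous => t; rewrite in_itv /= => t01.
  have /aB /H[Oa _ _] := t01.
  apply: ex_derive; apply: is_derive_segment.
  by apply: diff_derivable; exact: df.
have [t + gE] := MVT ltr01 gd gc.
rewrite in_itv /= => /andP[t0 t1].
have /aB /H[Oa h0 h1] : 0 <= t <= 1 by rewrite !ltW.
have -> : f q' - f q = 'D_w f (a t).
  rewrite -[RHS]mulr1 -[in X in _ * X](subr0 1) -gE /g /a scale0r addr0.
  by rewrite scale1r /w addrCA subrr addr0.
rewrite (derive_frame _ fr (df _ Oa)) (derive_frame _ fr (df _ Op)).
rewrite /GRing.scale /= opprD addrACA -!mulrBr.
apply: le_trans (ler_normD _ _) _; rewrite !normrM.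
have -> : eps * `|w| = `|w| * (eps / 2) + `|w| * (eps / 2) by lra.
by apply: lerD; apply: ler_pM; rewrite ?normr_ge0 ?n0 ?n1 ?(ltW h0) ?(ltW h1).
Qed.

Lemma strict_approx_line (O : set R) (f : R -> R) (x eps : R) :
  open O -> Ck_open 1 O f -> O x -> 0 < eps ->
  exists2 d : R, 0 < d & forall y z, `|y - x| < d -> `|z - x| < d ->
    `|f z - f y - (z - y) * 'D_1 f x| <= eps * `|z - y|.
Proof.
move=> oO Cf Ox e0.
have [//|//|d d0 H] := strict_approx (@line_frame R) _ _ oO Cf Ox e0.
exists d => // y z yx zx.
have := H y z yx zx; rewrite (derive_frame _ (@line_frame R)) ?derive0.
  by rewrite scaler0 addr0.
by case: Cf => df _; exact: df.
Qed.

Lemma strict_approx_plane (O : set (plane R)) (f : plane R -> R) p (eps : R) :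
  open O -> Ck_open 1 O f -> O p -> 0 < eps ->
  exists2 d : R, 0 < d & forall q q', `|q - p| < d -> `|q' - p| < d ->
    `|f q' - f q - ((q' 0 0 - q 0 0) * 'D_(pt 1 0) f p +
                    (q' 0 1 - q 0 1) * 'D_(pt 0 1) f p)| <= eps * `|q' - q|.
Proof.
move=> oO Cf Op e0.
have [||d d0 H] := strict_approx (@plane_frame R) _ _ oO Cf Op e0.
- by move=> v; exact: normr_coord.
- by move=> v; exact: normr_coord.
exists d => // q q' qp q'p.
have := H q q' qp q'p; rewrite (derive_frame _ (@plane_frame R)).
  by rewrite /= /coordinate /= !mxE.
by case: Cf => df _; exact: df.
Qed.

End StrictDifferentiability.

(** * Derivatives within a subset of the line *)

Section OneVariable.
Context {R : realType}.
Implicit Types (D : set R) (u v : R -> R) (x d : R).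

(** The set [D] need not be a neighborhood of [x], so one-sided derivatives at the end of an
    interval are covered. The value [d] is determined by [u] as soon as [D] clusters at [x]. *)
Definition derivative_within D u x d : Prop :=
  forall eps, 0 < eps -> exists2 r : R, 0 < r &
    forall y, D y -> `|y - x| < r -> `|u y - u x - (y - x) * d| <= eps * `|y - x|.

Definition clusters_at D x : Prop :=
  forall r : R, 0 < r -> exists y, [/\ D y, y != x & `|y - x| < r].

Lemma derivative_within_sub D D' u x d :
  D' `<=` D -> derivative_within D u x d -> derivative_within D' u x d.
Proof.
by move=> sD du e /du[r r0 H]; exists r => // y /sD; exact: H.
Qed.

Lemma derivative_within_near D D' u u' x d r : 0 < r -> u x = u' x ->
  (forall y, D' y -> `|y - x| < r -> D y /\ u y = u' y) ->
  derivative_within D u x d -> derivative_within D' u' x d.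
Proof.
move=> r0 ux uy du e /du[s s0 H]; exists (Num.min r s).
  by rewrite lt_min r0.
by move=> y D'y; rewrite lt_min => /andP[/(uy y D'y)[Dy <-] ys]; rewrite -ux; exact: H.
Qed.

Lemma derivative_withinB D u u' x d d' : derivative_within D u x d ->
  derivative_within D u' x d' -> derivative_within D (fun y => u y - u' y) x (d - d').
Proof.
move=> du du' e e0; have e20 : 0 < e / 2 by lra.
have [r r0 H] := du _ e20; have [r' r'0 H'] := du' _ e20.
exists (Num.min r r'); first by rewrite lt_min r0.
move=> y Dy; rewrite lt_min => /andP[/(H y Dy) h /(H' y Dy) h'].
have -> : u y - u' y - (u x - u' x) - (y - x) * (d - d') =
  (u y - u x - (y - x) * d) - (u' y - u' x - (y - x) * d') by ring.
by apply: le_trans (ler_normB _ _) _; lra.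
Qed.

Lemma is_derive_within D u x d : is_derive x (1 : R) u d -> derivative_within D u x d.
Proof.
move=> [/derivable1_diffP du dE] e e0.
have [r r0 H] := (nearP _ _).1 (differentiable_approx du e0).
exists r => // y _ /H; rewrite -[in X in 'd u x X](mulr1 (y - x)).
by rewrite linearZ /= -deriveE// dE.
Qed.

Lemma approx_is_derive u x d : derivative_within setT u x d -> is_derive x (1 : R) u d.
Proof.
move=> du; have [|df dE] := @approx_differentiable _ _ _ u (line d) x
    (@line_continuous _ _ d).
  by move=> e /du[r r0 H]; apply/nearP; exists r => // y; exact: H.
split; first exact/derivable1_diffP.
by rewrite deriveE// dE; exact: mul1r.
Qed.

Lemma derivative_within_ge0 D u x d : clusters_at D x ->
  derivative_within D u x d ->
  (forall y, D y -> 0 <= (u y - u x) * (y - x)) -> 0 <= d.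
Proof.
move=> ax du mu; rewrite leNgt; apply/negP => d0.
have [|r r0 H] := du (- d / 2); first lra.
have [y [Dy yx /(H y Dy)]] := ax r r0.
have := mu y Dy; move: yx; rewrite -subr_eq0; set h := y - x; set k := u y - u x.
move=> h0 kh /ler_normlP[h1 h2].
have [hp|hn] := ltrP 0 h.
  rewrite gtr0_norm// in h1 h2.
  have hd : h * d < 0 by rewrite pmulr_rlt0.
  have k0 : k < 0 by lra.
  by move: kh; rewrite leNgt nmulr_rlt0// hp.
have {}hn : h < 0 by rewrite lt_neqAle h0.
rewrite ltr0_norm// in h1 h2.
have hd : 0 < h * d by rewrite nmulr_rgt0.
have k0 : 0 < k by lra.
by move: kh; rewrite leNgt pmulr_rlt0// hn.
Qed.

Lemma derivative_within_unique D u x d d' : clusters_at D x ->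
  derivative_within D u x d -> derivative_within D u x d' -> d = d'.
Proof.
(* The function [u - u] has both [d' - d] and [d - d'] as derivatives and has zero increments, so
   both numbers are nonnegative. *)
move=> ax du du'; have c0 y : D y -> 0 <= (u y - u y - (u x - u x)) * (y - x).
  by move=> _; rewrite !subrr mul0r.
have := derivative_within_ge0 ax (derivative_withinB du' du) c0.
have := derivative_within_ge0 ax (derivative_withinB du du') c0.
by lra.
Qed.

(** Inside the interval the function has an ordinary derivative; at an end point the one-sided
    derivative supplies the continuity that the mean value theorem asks for. *)
Lemma derivative_within0_cst D u : is_interval D ->
  (forall x, D x -> derivative_within D u x 0) ->
  forall x y, D x -> D y -> u x = u y.
Proof.
move=> iD du x y Dx Dy; wlog xy : x y Dx Dy / x < y.
  by case: (ltgtP x y) => [xy|yx|->//] h; [exact: h|apply/esym; exact: h].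
have sD z : x <= z <= y -> D z by move=> /andP[xz zy]; apply: (iD x y) => //; rewrite xz.
have dz z : z \in `]x, y[ -> is_derive z (1 : R) u (cst 0 z).
  rewrite in_itv /= => /andP[xz zy].
  apply: approx_is_derive.
  have Dz : D z by apply: sD; rewrite !ltW.
  apply: (derivative_within_near (r := Num.min (z - x) (y - z)) _ _ _ (du z Dz)) => //.
    by rewrite lt_min !subr_gt0 xz.
  move=> w _; rewrite lt_min => /andP[/ltr_normlP[h1 h2] /ltr_normlP[h3 h4]].
  by split=> //; apply: sD; apply/andP; split; lra.
have cu : {within `[x, y], continuous u}.
  apply/subspace_continuousP => z /=; rewrite in_itv /= => /sD Dz.
  apply/cvgrPdist_le => e e0.
  have [r r0 H] := du z Dz 1 ltr01.
  near=> w; have wxy : w \in `[x, y] by near: w; exact: withinT.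
  have /H : D w by apply: sD; move: wxy; rewrite in_itv.
  have wr : `|w - z| < Num.min r e.
    near: w; apply: cvg_within; apply: (nearP z _).2.
    exists (Num.min r e) => //.
    by rewrite lt_min r0.
  move: wr; rewrite lt_min => /andP[wr we] /(_ wr).
  by rewrite mulr0 subr0 mul1r distrC => /le_trans; apply; exact: ltW.
have [z _] := MVT xy dz cu.
by rewrite mul0r => /subr0_eq.
Unshelve. all: by end_near. Qed.

Lemma itv_clusters_at (I : interval R) (x : R) :
  (exists a b, [/\ a \in I, b \in I & a < b]) -> x \in I ->
  clusters_at [set` I] x.
Proof.
move=> [a [b [aI bI ab]]] xI r r0.
have iI := @interval_is_interval _ I.
have [xb|bx] := ltP x b.
  exists (Num.min b (x + r / 2)); split.
  - by apply: (iI x b) => //; rewrite le_min ge_min lexx ltW//= lerDl ltW// divr_gt0.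
  - by rewrite gt_eqF// lt_min xb ltrDl divr_gt0.
  - rewrite ger0_norm; last by rewrite subr_ge0 le_min ltW//= lerDl; lra.
    by rewrite ltrBlDr gt_min; apply/orP; right; lra.
have ax : a < x by exact: lt_le_trans bx.
exists (Num.max a (x - r / 2)); split.
- by apply: (iI a x) => //; rewrite le_max lexx/= ge_max ltW//= gerBl ltW// divr_gt0.
- by rewrite lt_eqF// gt_max ax; lra.
- rewrite ler0_norm; last by rewrite subr_le0 ge_max ltW//=; lra.
  by rewrite opprB ltrBlDr -ltrBlDl lt_max; apply/orP; right; lra.
Qed.

(** The integral starts at [c - d / 2] rather than at [c], so that a two-sided derivative is
    available on both sides of [c]. *)
Lemma antiderivative (O : set R) v (c : R) : open O -> O c ->
  (forall x, O x -> {for x, continuous v}) ->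
  exists V, exists2 r : R, 0 < r &
    forall x, `|x - c| < r -> O x /\ is_derive x (1 : R) V (v x).
Proof.
move=> oO Oc cv; have [d d0 dO] := (nearP _ _).1 (open_near oO Oc).
pose a := c - d / 2; pose b := c + d / 2.
have abO x : a <= x <= b -> O x.
  by move=> /andP[ax xb]; apply: dO; apply/ltr_normlP; rewrite /a /b in ax xb; split; lra.
have ab : a < b by rewrite /a /b; lra.
have cab : {within `[a, b], continuous v}.
  by apply: continuous_in_subspaceT => x; rewrite inE /= in_itv /= => /abO; exact: cv.
have iv : lebesgue_measure.-integrable `[a, b] (EFin \o v).
  exact: continuous_compact_integrable (@segment_compact _ a b) cab.
exists (fun x => (\int[lebesgue_measure]_(t in [set` `[a, x]]) v t)%R), (d / 2); first by lra.
move=> x /ltr_normlP[h1 h2].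
have Ox : O x by apply: abO; apply/andP; rewrite /a /b; split; lra.
split=> //.
have [|||df dE] := @continuous_FTC1_closed _ v a x b _ iv.
- by rewrite /b; lra.
- by rewrite /a; lra.
- exact: cv.
by split; [exact df|rewrite -derive1E; exact dE].
Qed.

End OneVariable.

(** * Germs of C^k maps and extensions *)

Section CkGerms.
Context {R : realType}.
Implicit Types V W X : normedModType R.

Definition Ck_at V W k (p : V) (f : V -> W) : Prop :=
  exists2 A : set V, open_nbhs p A & Ck_open k A f.

Lemma Ck_at_shrink V W k (p : V) (f : V -> W) (P : set V) :
  Ck_at k p f -> nbhs p P ->
  exists A : set V, [/\ open_nbhs p A, Ck_open k A f & A `<=` P].
Proof.
case=> A [oO Op] Cf nP; exists (A `&` P^°); split.
- by split; [apply: (openI oO); exact: open_interior|split].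
- exact: Ck_open_sub Cf.
- by move=> q [_ /interior_subset].
Qed.

Lemma Ck_at_sub V W k (p : V) (f : V -> W) :
  Ck_at k p f -> \forall q \near p, Ck_at k q f.
Proof.
by move=> [A [oO Op] Cf]; apply: filterS (open_near oO Op) => q Oq; exists A.
Qed.

Lemma Ck_at_near_eq V W k (p : V) (f g : V -> W) :
  (\forall q \near p, f q = g q) -> Ck_at k p f -> Ck_at k p g.
Proof.
move=> fg /Ck_at_shrink /(_ fg)[A [[oO Op] Cf Oe]].
by exists A => //; exact: Ck_open_eq Cf.
Qed.

Lemma Ck_at_le V W j k (p : V) (f : V -> W) :
  (j <= k)%N -> Ck_at k p f -> Ck_at j p f.
Proof. by move=> jk [A nO Cf]; exists A => //; exact: Ck_open_le Cf. Qed.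

Lemma Ck_at_continuous V W k (p : V) (f : V -> W) :
  Ck_at k p f -> {for p, continuous f}.
Proof. by move=> [A [_ Op] /Ck_open0]; exact. Qed.

Lemma Ck_at_differentiable V W k (p : V) (f : V -> W) :
  Ck_at k.+1 p f -> differentiable f p.
Proof. by move=> [A [_ Op] [+ _]]; exact. Qed.

Lemma Ck_at_derive V W k (p : V) (f : V -> W) v :
  Ck_at k.+1 p f -> Ck_at k p ('D_v f).
Proof. by move=> [A nO [_ Df]]; exists A => //; exact: Df. Qed.

Lemma Ck_at_cst V W k (p : V) (w : W) : Ck_at k p (fun=> w).
Proof.
by exists setT; [split=> //; exact: openT|apply: Ck_open_cst; exact: openT].
Qed.

Lemma Ck_at_lin V W k (p : V) (f : {linear V -> W}) :
  continuous f -> Ck_at k p f.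
Proof.
move=> cf; exists setT; first by split=> //; exact: openT.
by apply: Ck_open_lin => //; exact: openT.
Qed.

Lemma Ck_at_id V k (p : V) : Ck_at k p (fun q => q).
Proof. by apply: (@Ck_at_lin _ _ _ _ idfun) => q; exact: cvg_id. Qed.

Lemma Ck_at2 V W X k (p : V) (f : V -> W) (g : V -> X) :
  Ck_at k p f -> Ck_at k p g ->
  exists A : set V, [/\ open_nbhs p A, Ck_open k A f & Ck_open k A g].
Proof.
move=> /Ck_at_shrink Cf [A [oO Op] Cg].
have [A' [nO' Cf' sO']] := Cf _ (open_near oO Op).
by exists A'; split=> //; exact: Ck_open_sub Cg.
Qed.

Lemma Ck_atD V W k (p : V) (f g : V -> W) :
  Ck_at k p f -> Ck_at k p g -> Ck_at k p (fun q => f q + g q).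
Proof.
by move=> Cf /(Ck_at2 Cf)[A [[oO Op] {}Cf Cg]]; exists A => //; exact: Ck_openD.
Qed.

Lemma Ck_atM V k (p : V) (f g : V -> R) :
  Ck_at k p f -> Ck_at k p g -> Ck_at k p (fun q => f q * g q).
Proof.
by move=> Cf /(Ck_at2 Cf)[A [[oO Op] {}Cf Cg]]; exists A => //; exact: Ck_openM.
Qed.

Lemma Ck_atN V k (p : V) (f : V -> R) : Ck_at k p f -> Ck_at k p (fun q => - f q).
Proof. by move=> [A [oO Op] Cf]; exists A => //; exact: Ck_openN. Qed.

Lemma Ck_atB V k (p : V) (f g : V -> R) :
  Ck_at k p f -> Ck_at k p g -> Ck_at k p (fun q => f q - g q).
Proof. by move=> Cf /Ck_atN; exact: Ck_atD. Qed.

Lemma Ck_atV V k (p : V) (f : V -> R) : f p != 0 ->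
  Ck_at k p f -> Ck_at k p (fun q => (f q)^-1).
Proof.
move=> f0 Cf; have cf := Ck_at_continuous Cf.
have nf : \forall q \near p, f q != 0 by apply: cvgr_neq0 cf f0.
have [A [[oO Op] {}Cf fO]] := Ck_at_shrink Cf nf.
by exists A => //; exact: Ck_openV.
Qed.

Lemma Ck_at_pt V k (p : V) (a b : V -> R) :
  Ck_at k p a -> Ck_at k p b -> Ck_at k p (fun q => pt (a q) (b q)).
Proof.
by move=> Ca /(Ck_at2 Ca)[A [[oO Op] {}Ca Cb]]; exists A => //; exact: Ck_open_pt.
Qed.

Lemma Ck_at_coord V k (p : V) (f : V -> plane R) i :
  Ck_at k p f -> Ck_at k p (fun q => f q 0 i).
Proof. by move=> [A [oO Op] Cf]; exists A => //; exact: Ck_open_coord. Qed.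

Lemma Ck_at_comp_frame V W (e0 e1 : W) (c0 c1 : {linear W -> R}) k
    (p : V) (f : V -> W) (g : W -> R) : frame e0 e1 c0 c1 ->
  Ck_at k p f -> Ck_at k (f p) g -> Ck_at k p (g \o f).
Proof.
move=> fr Cf [A' [oO' Op'] Cg]; have cf := Ck_at_continuous Cf.
have nO : nbhs p (f @^-1` A') by exact: cf (open_near oO' Op').
have [A [[oO Op] {}Cf sO]] := Ck_at_shrink Cf nO.
by exists A => //; exact: Ck_open_comp fr oO sO Cf Cg.
Qed.

Lemma Ck_at_comp V k (p : V) (f : V -> R) (g : R -> R) :
  Ck_at k p f -> Ck_at k (f p) g -> Ck_at k p (fun q => g (f q)).
Proof. exact: (Ck_at_comp_frame (@line_frame R)). Qed.

Lemma Ck_at_comp_plane V k (p : V) (f : V -> plane R) (g : plane R -> R) :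
  Ck_at k p f -> Ck_at k (f p) g -> Ck_at k p (fun q => g (f q)).
Proof. exact: (Ck_at_comp_frame (@plane_frame R)). Qed.

Lemma Ck_at_comp_map V k (p : V) (f : V -> plane R) (g : plane R -> plane R) :
  Ck_at k p f -> Ck_at k (f p) g -> Ck_at k p (fun q => g (f q)).
Proof.
move=> Cf Cg; apply: (@Ck_at_near_eq _ _ _ _ (fun q => pt (g (f q) 0 0) (g (f q) 0 1))).
  by near=> q; rewrite pt_eta.
apply: Ck_at_pt.
  by apply: (Ck_at_comp_plane (g := fun z => g z 0 0) Cf); exact: Ck_at_coord.
by apply: (Ck_at_comp_plane (g := fun z => g z 0 1) Cf); exact: Ck_at_coord.
Unshelve. all: by end_near. Qed.

Lemma Ck_at_primitive k (c : R) (u v : R -> R) :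
  (\forall x \near c, is_derive x (1 : R) u (v x)) ->
  Ck_at k c v -> Ck_at k.+1 c u.
Proof.
move=> nu /Ck_at_shrink /(_ nu)[A [[oO Oc] Cv dO]]; exists A => //; split.
  by move=> x /dO[/derivable1_diffP].
move=> w; apply: Ck_open_eq oO _ (Ck_openM oO (Ck_open_cst k w oO) Cv) => x Ox.
have [du dE] := dO x Ox.
have {}du : differentiable u x by exact/derivable1_diffP.
by rewrite (derive_frame _ (@line_frame R) du) derive0 scaler0 addr0 dE.
Qed.

Definition extends_Ck V W k (D : set V) (f : V -> W) (p : V) : Prop :=
  exists F, Ck_extension k D f p F.

Lemma Ck_extensionP V W k (D : set V) (f : V -> W) (p : V) F :
  Ck_extension k D f p F <->
  Ck_at k p F /\ \forall q \near p, D q -> F q = f q.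
Proof.
split=> [[A [[oO Op] CF Ff]]|[CF nF]].
  by split; [exists A|apply: filterS (open_near oO Op)].
by have [A [nO {}CF sO]] := Ck_at_shrink CF nF; exists A.
Qed.

Lemma Ck_extension_le V W j k (D : set V) (f : V -> W) (p : V) F :
  (j <= k)%N -> Ck_extension k D f p F -> Ck_extension j D f p F.
Proof. by move=> jk [A [nA CF FE]]; exists A; split=> //; exact: Ck_open_le CF. Qed.

End CkGerms.

(** * Extending functions past the ends of an interval *)

Section ExtensionsOnIntervals.
Context {R : realType} (I : interval R).
Context (I_nondegenerate : exists a b, [/\ a \in I, b \in I & a < b]).
Implicit Types (u v : R -> R) (c : R).

Lemma itv_ball_is_interval c (r : R) :
  is_interval [set x | x \in I /\ `|x - c| < r].
Proof.
move=> x y [xI /ltr_normlP[x1 x2]] [yI /ltr_normlP[y1 y2]] z /andP[xz zy].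
split; first by apply: (@interval_is_interval _ I x y) => //; rewrite xz.
by apply/ltr_normlP; split; lra.
Qed.

(** A primitive of [v] exists on both sides of [c], even if [c] is an end of [I]. Its difference
    with [u] has zero derivative within the part of [I] near [c], hence is constant there, and a
    shift by [u c - V c] turns the primitive into an extension of [u]. *)
Lemma extends_Ck_primitive k u v c : c \in I ->
  Ck_at k c v ->
  (\forall x \near c, x \in I -> derivative_within [set` I] u x (v x)) ->
  extends_Ck k.+1 [set` I] u c.
Proof.
move=> cI Cv nu; have [A [[oO Oc] {}Cv sO]] := Ck_at_shrink Cv nu.
have [V [r r0 dV]] := antiderivative oO Oc (Ck_open0 Cv).
exists (fun x => V x + (u c - V c)); apply/Ck_extensionP; split.
  apply: Ck_atD (Ck_at_cst _ _ _); apply: (@Ck_at_primitive _ k c V v); last by exists A.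
  by apply/nearP; exists r => // x /dV[].
apply/nearP; exists r => // x xc xI.
pose D := [set x | x \in I /\ `|x - c| < r].
have d0 z : D z -> derivative_within D (fun x => u x - V x) z 0.
  move=> [zI zc]; have [Oz dVz] := dV z zc.
  rewrite -(subrr (v z)); apply: derivative_withinB; last exact: is_derive_within.
  by apply: derivative_within_sub (sO z Oz zI) => y [].
have Dc : D c by split; rewrite // subrr normr0.
have := derivative_within0_cst (@itv_ball_is_interval c r) d0 (conj xI xc) Dc.
by move=> /= h; lra.
Qed.

(** Near [c] one clamp suffices: [Num.max c] if [c] is the least point of [I], [Num.min c] if it is
    the greatest, and the identity otherwise. *)
Lemma itv_retraction c : c \in I -> exists2 r : R -> R,
  (forall x y, `|r x - r y| <= `|x - y|) &
  (forall x, x \in I -> r x = x) /\ \forall x \near c, r x \in I.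
Proof.
move=> cI; have iI := @interval_is_interval _ I.
have [[a [aI ac]]|noa] := pselect (exists a, a \in I /\ a < c); last first.
  have le_c x : x \in I -> c <= x by move=> xI; rewrite leNgt; apply/negP => xc; apply: noa; exists x.
  have [b bI cb] : exists2 b, b \in I & c < b.
    have [a [b [aI bI ab]]] := I_nondegenerate.
    by exists b => //; apply: le_lt_trans ab; exact: le_c.
  exists (Num.max c).
    move=> x y; have := ler_norm (x - y); have := ler_norm (y - x).
    rewrite (distrC y x) => n1 n2; apply/ler_normlP.
    by case: (leP c x); case: (leP c y) => h1 h2; split; lra.
  split; first by move=> x /le_c cx; apply/max_idPr.
  apply/nearP; exists (b - c) => [|x /ltr_normlP[h1 h2]]; first lra.
  by apply: (iI c b) => //; rewrite le_max lexx /= ge_max (ltW cb) /=; lra.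
have [[b [bI cb]]|nob] := pselect (exists b, b \in I /\ c < b); last first.
  have le_c x : x \in I -> x <= c by move=> xI; rewrite leNgt; apply/negP => xc; apply: nob; exists x.
  exists (Num.min c).
    move=> x y; have := ler_norm (x - y); have := ler_norm (y - x).
    rewrite (distrC y x) => n1 n2; apply/ler_normlP.
    by case: (leP c x); case: (leP c y) => h1 h2; split; lra.
  split; first by move=> x /le_c cx; apply/min_idPr.
  apply/nearP; exists (c - a) => [|x /ltr_normlP[h1 h2]]; first lra.
  by apply: (iI a c) => //; rewrite le_min ge_min lexx (ltW ac) /= andbT; lra.
exists id => //; split=> //.
apply/nearP; exists (Num.min (c - a) (b - c)).
  by rewrite lt_min !subr_gt0 ac.
move=> x; rewrite lt_min => /andP[/ltr_normlP[h1 h2] /ltr_normlP[h3 h4]].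
by apply: (iI a b) => //; apply/andP; split; lra.
Qed.

(** Composition with the retraction: it is 1-Lipschitz and sends points near [c] into [I], so
    continuity within [I] becomes continuity on a full neighborhood. *)
Lemma extends_C0 v c : c \in I ->
  (\forall x \near c, x \in I -> forall eps, 0 < eps ->
    exists2 d : R, 0 < d &
      forall y, y \in I -> `|y - x| < d -> `|v y - v x| < eps) ->
  extends_Ck 0 [set` I] v c.
Proof.
move=> cI nv; have [r r1 [rI nr]] := itv_retraction cI.
exists (v \o r); apply/Ck_extensionP; split; last first.
  by near=> x => xI /=; rewrite rI.
have [d d0 H] := (nearP _ _).1 (filterI nv nr).
exists [set x | `|x - c| < d]; first split.
- rewrite (_ : [set x | _] = ball_ Num.norm c d); first exact: ball_open.
  by apply/seteqP; split=> x; rewrite /ball_ /= distrC.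
- by rewrite /= subrr normr0.
move=> x /= xc; apply/cvgrPdist_lt => e e0.
have [_ rxI] := H x xc.
have rc : `|r x - c| < d by apply: le_lt_trans xc; rewrite -{1}(rI c cI).
have [vr _] := H _ rc.
have [d' d'0 H'] := vr rxI e e0.
apply: (nearP x _).2; exists (Num.min d' (d - `|x - c|)).
  by rewrite lt_min d'0 subr_gt0.
move=> y; rewrite lt_min => /andP[yd' yd] /=.
rewrite distrC; apply: H'.
  apply: (H y _).2; rewrite -(subrK x y) -addrA.
  by apply: le_lt_trans (ler_normD _ _) _; rewrite -ltrBrDr.
exact: le_lt_trans yd'.
Unshelve. all: by end_near. Qed.

End ExtensionsOnIntervals.

(** * Contraction of slopes *)

Section SlopeContraction.
Context {R : realType}.
Implicit Types (J : set R) (u h : R -> R).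

Definition slope u (y z : R) : R := (u z - u y) / (z - y).

(** Neither point has to be [x]. A limit of slopes over such pairs is a strict derivative, which is
    continuous in [x] wherever it exists. *)
Definition near_pair J (x r y z : R) : Prop :=
  [/\ J y, J z, y != z, `|y - x| < r & `|z - x| < r].

Lemma slopeE u y z : y != z -> u z - u y = (z - y) * slope u y z.
Proof. by move=> yz; rewrite /slope mulrC divfK// subr_eq0 eq_sym. Qed.

Lemma near_pair_le J x r r' y z : r <= r' -> near_pair J x r y z -> near_pair J x r' y z.
Proof.
by move=> rr' [Jy Jz yz yx zx]; split=> //; [exact: lt_le_trans yx _|exact: lt_le_trans zx _].
Qed.

Lemma expr_small (rho eps : R) : 0 <= rho < 1 -> 0 < eps -> exists n, rho ^+ n < eps.
Proof.
move=> /andP[r0 r1] e0.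
have /cvgrPdist_lt/(_ _ e0)[n _ /(_ n (leqnn n))] := cvg_expr (z := rho) ltac:(by rewrite ger0_norm).
by rewrite /= sub0r normrN ger0_norm ?exprn_ge0//; exists n.
Qed.

Section Oscillation.
Context (J : set R) (u h : R -> R) (rho B : R).
Context (rho01 : 0 <= rho < 1).
Context (hJ : forall x, J x -> J (h x)).
Context (hC : forall x, J x -> forall eps, 0 < eps ->
  exists2 r : R, 0 < r & forall y, J y -> `|y - x| < r -> `|h y - h x| < eps).
Context (hI : forall x y, J x -> J y -> x != y -> h x != h y).
Context (uB : forall y z, J y -> J z -> y != z -> `|slope u y z| <= B).
Context (contr : forall x, J x -> forall eps, 0 < eps ->
  exists2 r : R, 0 < r & forall y z y' z',
    near_pair J x r y z -> near_pair J x r y' z' ->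
    `|slope u y z - slope u y' z'| <=
      rho * `|slope u (h y) (h z) - slope u (h y') (h z')| + eps).

(** By induction on [n], slopes near [x] oscillate by at most [K * s ^+ n], within a radius
    depending on [n] and [x]. The step uses the bound near [h x]; as [rho < s], the margin
    [(s - rho) * (K * s ^+ n)] pays for the error term of [contr]. The initial [K] is twice the
    bound on slopes, plus one to make it positive. *)
Lemma slope_oscillation x eps : J x -> 0 < eps ->
  exists2 r : R, 0 < r & forall y z y' z',
    near_pair J x r y z -> near_pair J x r y' z' ->
    `|slope u y z - slope u y' z'| <= eps.
Proof.
move=> Jx e0; have /andP[rho0 rho1] := rho01.
pose s := (rho + 1) / 2; have s01 : 0 <= s < 1 by rewrite /s; lra.
have rs : rho < s by rewrite /s; lra.
pose K := 2 * `|B| + 1; have K0 : 0 < K by rewrite /K; have := normr_ge0 B; lra.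
suff H n : forall x, J x -> exists2 r : R, 0 < r & forall y z y' z',
    near_pair J x r y z -> near_pair J x r y' z' ->
    `|slope u y z - slope u y' z'| <= K * s ^+ n.
  have [n sn] := expr_small s01 (divr_gt0 e0 K0).
  have [r r0 {}H] := H n x Jx; exists r => // y z y' z' p p'.
  apply: le_trans (H _ _ _ _ p p') _.
  by move: sn; rewrite ltr_pdivlMr// mulrC => /ltW.
elim: n {x Jx} => [|n IH] x Jx.
  exists 1 => // y z y' z' [Jy Jz yz _ _] [Jy' Jz' yz' _ _].
  rewrite expr0 mulr1 /K; apply: le_trans (ler_normB _ _) _.
  have := uB Jy Jz yz; have := uB Jy' Jz' yz'; have := ler_norm B; lra.
have sn0 : 0 < s ^+ n by apply: exprn_gt0; lra.
have [r r0 H] := IH _ (hJ Jx).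
have [r1 r10 H1] := hC Jx r0.
have e10 : 0 < (s - rho) * (K * s ^+ n) by rewrite !mulr_gt0// subr_gt0.
have [r2 r20 H2] := contr Jx e10.
exists (Num.min r1 r2); first by rewrite lt_min r10.
have hp y z : near_pair J x (Num.min r1 r2) y z -> near_pair J (h x) r (h y) (h z).
  move=> [Jy Jz yz]; rewrite !lt_min => /andP[y1 _] /andP[z1 _].
  by split; [exact: hJ|exact: hJ|exact: hI|exact: H1|exact: H1].
move=> y z y' z' p p'.
have := H2 y z y' z' (near_pair_le _ p) (near_pair_le _ p').
rewrite ge_min lexx orbT => /(_ isT isT) /le_trans; apply.
have := H _ _ _ _ (hp _ _ p) (hp _ _ p').
set a := `|_|; set c := K * _ => ac.
have -> : K * s ^+ n.+1 = rho * c + (s - rho) * c by rewrite exprS /c; ring.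
by rewrite lerD2r ler_wpM2l.
Qed.

End Oscillation.

(** A Cauchy criterion, with completeness entering through a supremum: [S] collects the numbers that
    bound the slopes from below for all pairs close enough to [x], so [sup S] is their lower limit.
    Where the oscillation is at most [eps], every slope is within [eps] of it. *)
Lemma slope_limit J u x : clusters_at J x -> J x ->
  (forall eps, 0 < eps -> exists2 r : R, 0 < r & forall y z y' z',
    near_pair J x r y z -> near_pair J x r y' z' ->
    `|slope u y z - slope u y' z'| <= eps) ->
  exists l : R, forall eps, 0 < eps -> exists2 r : R, 0 < r &
    forall y z, near_pair J x r y z -> `|slope u y z - l| <= eps.
Proof.
move=> ax Jx osc.
have pair r : 0 < r -> exists y z, near_pair J x r y z.
  move=> r0; have [y [Jy yx yr]] := ax r r0.
  by exists x, y; split=> //; rewrite ?subrr ?normr0// eq_sym.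
pose S := [set m : R | exists2 r : R, 0 < r &
  forall y z, near_pair J x r y z -> m <= slope u y z].
have low eps y0 z0 r : 0 < r -> (forall y z y' z',
    near_pair J x r y z -> near_pair J x r y' z' ->
    `|slope u y z - slope u y' z'| <= eps) ->
    near_pair J x r y0 z0 -> S (slope u y0 z0 - eps) /\ ubound S (slope u y0 z0 + eps).
  move=> r0 H p0; split.
    by exists r => // y z p; have /ler_normlP[h1 h2] := H _ _ _ _ p p0; lra.
  move=> m [r' r'0 H']; have [|y [z p]] := pair (Num.min r r').
    by rewrite lt_min r0.
  have := H' y z (near_pair_le _ p); rewrite ge_min lexx orbT => /(_ isT).
  have := H _ _ _ _ (near_pair_le _ p) p0; rewrite ge_min lexx => /(_ isT) /ler_normlP[h1 h2] h3.
  lra.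
have hS : has_sup S.
  have [r r0 H] := osc 1 ltr01; have [y [z p]] := pair r r0.
  by have [S1 S2] := low _ _ _ _ r0 H p; split; [exists (slope u y z - 1)|exists (slope u y z + 1)].
exists (sup S) => e e0; have [r r0 H] := osc e e0; exists r => // y z p.
have [S1 S2] := low _ _ _ _ r0 H p.
have h1 : slope u y z - e <= sup S by apply: ub_le_sup => //; case: hS.
have h2 : sup S <= slope u y z + e by apply: ge_sup => //; case: hS.
by apply/ler_normlP; split; lra.
Qed.

End SlopeContraction.

(** Contraction makes the slopes converge at every [x] of [J] to some [v x]. The function [v] is
    continuous on [J], hence extends continuously past the ends of [I], and [u] is one of its
    primitives within [I]. *)
Lemma extends_C1_contraction (R : realType) (I : interval R) (c d : R) (u h : R -> R) (rho B : R) :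
  let J := [set x | x \in I /\ `|x - c| < d] in
  (exists a b, [/\ a \in I, b \in I & a < b]) ->
  c \in I -> 0 < d -> 0 <= rho < 1 ->
  (forall x, J x -> J (h x)) ->
  (forall x, J x -> forall eps, 0 < eps ->
    exists2 r : R, 0 < r & forall y, J y -> `|y - x| < r -> `|h y - h x| < eps) ->
  (forall x y, J x -> J y -> x != y -> h x != h y) ->
  (forall y z, J y -> J z -> y != z -> `|slope u y z| <= B) ->
  (forall x, J x -> forall eps, 0 < eps ->
    exists2 r : R, 0 < r & forall y z y' z',
      near_pair J x r y z -> near_pair J x r y' z' ->
      `|slope u y z - slope u y' z'| <=
        rho * `|slope u (h y) (h z) - slope u (h y') (h z')| + eps) ->
  extends_Ck 1 [set` I] u c.
Proof.
move=> J Ind cI d0 rho01 hJ hC hI uB contr.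
have nJ : \forall x \near c, x \in I -> J x.
  by apply/nearP; exists d => // x xd xI.
have aJ x : J x -> clusters_at J x.
  move=> [xI xd] r r0; have [|y [yI yx]] := itv_clusters_at Ind xI (r := Num.min r (d - `|x - c|)).
    by rewrite lt_min r0 subr_gt0.
  rewrite lt_min => /andP[yr yd]; exists y; split=> //; split=> //.
  rewrite -(subrK x y) -addrA; apply: le_lt_trans (ler_normD _ _) _; lra.
have osc x (Jx : J x) eps := slope_oscillation rho01 hJ hC hI uB contr Jx (eps := eps).
have [v vP] : exists v : R -> R, forall x, J x -> forall eps, 0 < eps ->
    exists2 r : R, 0 < r & forall y z, near_pair J x r y z -> `|slope u y z - v x| <= eps.
  suff vex x : exists l, J x -> forall eps, 0 < eps ->
      exists2 r : R, 0 < r & forall y z, near_pair J x r y z -> `|slope u y z - l| <= eps.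
    by have [v vP] := boolp.choice vex; exists v.
  have [Jx|nJx] := pselect (J x); last by exists 0.
  by have [l lP] := slope_limit (aJ x Jx) Jx (osc x Jx); exists l.
(* A pair close enough to [y] is also a pair close to [x], so one and the same slope is within
   [e / 3] of both [v y] and [v x]. *)
have vC x : J x -> forall eps, 0 < eps -> exists2 r : R, 0 < r &
    forall y, J y -> `|y - x| < r -> `|v y - v x| < eps.
  move=> Jx e e0; have e30 : 0 < e / 3 by lra.
  have [r r0 H] := vP x Jx _ e30; exists r => // y Jy yx.
  have [r' r'0 H'] := vP y Jy _ e30.
  have [|z [Jz zy]] := aJ y Jy (Num.min r' (r - `|y - x|)).
    by rewrite lt_min r'0 subr_gt0.
  rewrite lt_min => /andP[zr' zr].
  have /H'/ler_normlP[h1 h2] : near_pair J y r' y z.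
    by split; rewrite ?subrr ?normr0// eq_sym.
  have /H/ler_normlP[h3 h4] : near_pair J x r y z.
    split; rewrite ?subrr ?normr0//; first by rewrite eq_sym.
    by rewrite -(subrK y z) -addrA; apply: le_lt_trans (ler_normD _ _) _; lra.
  by apply/ltr_normlP; split; lra.
have [w /Ck_extensionP[Cw wv]] : extends_Ck 0 [set` I] v c.
  apply: extends_C0 => //; apply: filterS nJ => x JI xI e e0.
  have Jx := JI xI; have [r r0 H] := vC x Jx e e0.
  have [_ xd] := Jx; exists (Num.min r (d - `|x - c|)).
    by rewrite lt_min r0 subr_gt0.
  move=> y yI; rewrite lt_min => /andP[yr yd]; apply: H => //; split=> //.
  by rewrite -(subrK x y) -addrA; apply: le_lt_trans (ler_normD _ _) _; lra.
apply: (extends_Ck_primitive cI Cw).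
near=> x => xI; have Jx : J x by move: xI; near: x.
have -> : w x = v x by move: xI; near: x.
move=> e e0; have [r r0 H] := vP x Jx e e0; have [_ xd] := Jx.
exists (Num.min r (d - `|x - c|)); first by rewrite lt_min r0 subr_gt0.
move=> y yI; rewrite lt_min => /andP[yr yd].
have [->|xy] := eqVneq x y; first by rewrite !subrr mul0r subrr normr0 mulr0.
have /H uxy : near_pair J x r x y.
  split=> //; rewrite ?subrr ?normr0//; split=> //.
  by rewrite -(subrK x y) -addrA; apply: le_lt_trans (ler_normD _ _) _; lra.
by rewrite (slopeE _ xy) -mulrBr normrM mulrC ler_wpM2r.
Unshelve. all: by end_near. Qed.

(** * Functional equations *)

Lemma is_derive_line_comp (R : realType) (f g : R -> R) (x : R) :
  derivable f x 1 -> derivable g (f x) 1 ->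
  is_derive x (1 : R) (g \o f) ('D_1 g (f x) * 'D_1 f x).
Proof.
move=> df dg; split; last by rewrite -!derive1E; exact: derive1_comp df dg.
move: df dg => /derivable1_diffP df /derivable1_diffP dg.
by apply: diff_derivable; exact: differentiable_comp.
Qed.

Section FunctionalEquation.
Context {R : realType} (I : interval R) (c : R).
Context (I_nondegenerate : exists a b, [/\ a \in I, b \in I & a < b]).
Context (cI : c \in I).
Implicit Types (u h : R -> R) (N : plane R -> R).

Lemma is_derive_graph N (a : R -> R) (x : R) :
  derivable a x 1 -> differentiable N (pt x (a x)) ->
  is_derive x (1 : R) (fun y => N (pt y (a y)))
    ('D_(pt 1 0) N (pt x (a x)) + 'D_1 a x * 'D_(pt 0 1) N (pt x (a x))).
Proof.
move=> da dN; have da' := da; move: da' => /derivable1_diffP da'.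
pose g (y : R) : plane R := line (pt 1 0) y + (line (pt 0 1) \o a) y.
have dg1 : differentiable (line (pt 1 0 : plane R)) x.
  by apply: (@linear_differentiable R R _ (line (pt 1 0))); exact: line_continuous.
have dg2 : differentiable (line (pt 0 1 : plane R) \o a) x.
  apply: differentiable_comp; first exact: da'.
  by apply: (@linear_differentiable R R _ (line (pt 0 1))); exact: line_continuous.
have dg : differentiable g x by exact: differentiableD.
have gE y : g y = pt y (a y) by rewrite /g /= -ptE.
have Dg : 'D_1 g x = pt 1 ('D_1 a x).
  rewrite /g deriveD; [|exact: diff_derivable..].
  rewrite (@derive_linear_comp R R R (plane R) (line (pt 0 1)) a x 1 (@line_continuous _ _ _) da').
  rewrite [in RHS]ptE; congr (_ + _).
  by rewrite deriveE// diff_lin//; exact: line_continuous.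
have -> : (fun y => N (pt y (a y))) = N \o g by apply/funext => y /=; rewrite gE.
have dN' : differentiable N (g x) by rewrite gE.
have dNg : differentiable (N \o g) x by exact: differentiable_comp.
split; first exact: diff_derivable.
rewrite deriveE// diff_comp//= -(deriveE _ dg) Dg -(deriveE _ dN') gE.
by rewrite (derive_frame _ (@plane_frame R) dN) /= /coordinate pt0 pt1 scale1r.
Qed.

Lemma derive_vertical N (q : plane R) :
  'D_(pt 0 1) N q = 'D_1 (fun t : R => N (pt (q 0 0) t)) (q 0 1).
Proof.
have E : (fun e : R => e^-1 *: ((N \o shift q) (e *: pt 0 1) - N q)) =
  (fun e => e^-1 *: (((fun t : R => N (pt (q 0 0) t)) \o shift (q 0 1))
    (e *: (1 : R)) - N (pt (q 0 0) (q 0 1)))).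
  apply/funext => e /=; rewrite pt_eta; congr (_ *: (N _ - _)).
  by rewrite [e *: (1 : R)]mulr1; apply: plane_eqP; rewrite !mxE /=; ring.
by rewrite /derive E.
Qed.

Lemma extension_derivative u F : Ck_extension 1 [set` I] u c F ->
  \forall x \near c, x \in I -> derivative_within [set` I] u x ('D_1 F x).
Proof.
move=> /Ck_extensionP[CF Fu].
near=> x => xI.
have [r r0 H] : exists2 r : R, 0 < r &
    forall y, `|y - x| < r -> [set` I] y -> F y = u y.
  by apply/nearP; near: x; exact: nbhs_interior Fu.
apply: (@derivative_within_near _ [set` I] _ F _ _ _ r) => //.
- by apply: H; rewrite ?subrr ?normr0.
- by move=> y yI yr; split=> //; exact: H.
apply: is_derive_within; apply: DeriveDef => //.
have CFx : Ck_at 1 x F by near: x; exact: Ck_at_sub CF.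
by apply: diff_derivable; exact: Ck_at_differentiable CFx.
Unshelve. all: by end_near. Qed.

Lemma extends_Ck_derivative k u F : Ck_extension 1 [set` I] u c F ->
  extends_Ck k [set` I] ('D_1 F) c -> extends_Ck k.+1 [set` I] u c.
Proof.
move=> EF [G /Ck_extensionP[CG GF]].
apply: extends_Ck_primitive cI CG _.
by apply: filterS2 (extension_derivative EF) GF => x h G' xI; rewrite G'//; exact: h.
Qed.


Tactic Notation "lra_using" hyp_list(l) := clear - l I_nondegenerate cI; lra.

(* The slopes of u satisfy slope(y,z) = N_x + N_t h' slope(h y,h z) + o(1),
   and |N_t h'| < 1, so they cannot oscillate at any point of J. *)
Lemma extends_C1_functional N u h :
  h c = c -> (\forall x \near c, x \in I -> h x \in I) ->
  Ck_at 1 c h -> 0 < `|'D_1 h c| -> `|'D_1 h c| < 1 ->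
  Ck_at 1 (pt c (u c)) N -> `|'D_(pt 0 1) N (pt c (u c))| < 1 ->
  extends_Ck 0 [set` I] u c ->
  (\forall x \near c, x \in I -> u x = N (pt x (u (h x)))) ->
  extends_Ck 1 [set` I] u c.
Proof.
move=> hc hI Ch l0 l1 CN b1 [u' /Ck_extensionP[Cu' u'u]] uN.
set l := 'D_1 h c in l0 l1; set P := pt c (u c) in CN b1.
set b := 'D_(pt 0 1) N P in b1; pose a := 'D_(pt 1 0) N P.
(* With this [e1], chords of [h] near [c] keep at least the fraction [e1] of their length and do not
   grow; in particular [h] is injective there. *)
have [e1 [e10 e1l e1l']] : exists e1, [/\ 0 < e1, e1 <= `|l| - e1 & `|l| + e1 <= 1].
  have [h1|h1] := lerP `|l| (1 - `|l|).
    by exists (`|l| / 2); split; lra.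
  by exists ((1 - `|l|) / 2); split; lra.
have [d1 d10 H1] : exists2 d : R, 0 < d &
    forall y z, `|y - c| < d -> `|z - c| < d ->
    `|h z - h y - (z - y) * l| <= e1 * `|z - y|.
  by case: Ch => A [oA Ac] Ch; exact: strict_approx_line oA Ch Ac e10.
(* The contraction factor [rho] below is |b| + [e2], halfway between |b| and 1. *)
pose e2 := (1 - `|b|) / 2; have e20 : 0 < e2 by rewrite /e2; lra.
have [d2 d20 H2] : exists2 d : R, 0 < d & forall q q', `|q - P| < d -> `|q' - P| < d ->
    `|N q' - N q - ((q' 0 0 - q 0 0) * a + (q' 0 1 - q 0 1) * b)| <= e2 * `|q' - q|.
  by case: CN => A [oA AP] CN; exact: strict_approx_plane oA CN AP e20.
pose rho := (1 + `|b|) / 2.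
have rho01 : 0 <= rho < 1 by rewrite /rho; have := normr_ge0 b; lra.
have [rho0 rho1] := andP rho01.
have [d3 d30 H3] : exists2 d : R, 0 < d & forall q, `|q - P| < d ->
    `|'D_(pt 0 1) N q| <= rho /\ Ck_at 1 q N.
  apply/nearP; apply: filterI (Ck_at_sub CN).
  have cb := Ck_at_continuous (Ck_at_derive (pt 0 1) CN).
  have := continuous_dist_lt cb e20; apply: filterS => q /ltW h1.
  have := ler_normB b (b - 'D_(pt 0 1) N q); rewrite opprB addrCA subrr addr0.
  move=> /le_trans; apply; apply: le_trans (_ : `|b| + e2 <= _); first by rewrite lerD2l.
  by rewrite /e2 /rho; lra_using b1.
have [d4 d40 H4] : exists2 d : R, 0 < d & forall x, `|x - c| < d ->
    [/\ `|'D_1 h x| <= 1, Ck_at 1 x h, x \in I -> h x \in I,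
     x \in I -> u x = N (pt x (u (h x))) &
     x \in I -> [/\ `|u x - u c| < d2, `|u x - u c| < d3 & `|u x - u c| < 1]].
  apply/nearP.
  have cl := Ck_at_continuous (Ck_at_derive (1 : R) Ch).
  have cu := Ck_at_continuous Cu'.
  have uc : u' c = u c by exact: (nbhs_singleton u'u).
  have nu (e : R) : 0 < e -> \forall x \near c, x \in I -> `|u x - u c| < e.
    move=> e0; have := continuous_dist_lt cu e0.
    by apply: filterS2 u'u => x u'x; rewrite distrC uc => + xI; rewrite u'x.
  near=> x; split.
  - have : `|'D_1 h c - 'D_1 h x| < 1 - `|l|.
      by near: x; apply: (continuous_dist_lt cl); rewrite subr_gt0.
    have k1 := ler_normB l (l - 'D_1 h x).
    by rewrite opprB addrCA subrr addr0 in k1; rewrite -/l => k2; lra_using k1 k2.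
  - by near: x; exact: Ck_at_sub Ch.
  - by near: x.
  - by near: x.
  - by move=> xI; split; move: xI; near: x; exact: nu.
pose d := Num.min (Num.min d1 d2) (Num.min d3 d4).
have d0 : 0 < d by rewrite /d !lt_min d10 d20 d30.
pose J := [set x | x \in I /\ `|x - c| < d].
have JP x : J x -> [/\ x \in I, `|x - c| < d1, `|x - c| < d2, `|x - c| < d3 & `|x - c| < d4].
  by move=> [xI]; rewrite /d !lt_min => /andP[/andP[? ?] /andP[? ?]]; split.
have hlip y z : J y -> J z -> `|h z - h y| <= `|z - y| /\ e1 * `|z - y| <= `|h z - h y|.
  move=> /JP[_ yd _ _ _] /JP[_ zd _ _ _].
  have := H1 y z yd zd; set w := h z - h y.
  have := lerB_dist ((z - y) * l) w; have := lerB_dist w ((z - y) * l).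
  rewrite [in X in _ -> X -> _]distrC normrM; have := normr_ge0 (z - y); nra.
have Jc : J c by split; rewrite // subrr normr0.
have hJ x : J x -> J (h x).
  move=> Jx; have [xI _ _ _ /H4[_ _ hxI _ _]] := JP x Jx; split; first exact: hxI.
  by case: (hlip c x Jc Jx) => + _; rewrite hc => /le_lt_trans; apply; case: Jx.
have JN x : J x -> `|pt x (u (h x)) - P| < d2 /\ `|pt x (u (h x)) - P| < d3.
  move=> Jx; have [xI _ xd2 xd3 _] := JP x Jx.
  have [hxI _ _ _ hxd] := JP _ (hJ x Jx); have [_ _ _ _ /(_ hxI)[u2 u3 _]] := H4 _ hxd.
  by rewrite /P ptB; split; apply: plane_norm_lt; rewrite ?pt0 ?pt1.
have Ju x : J x -> u x = N (pt x (u (h x))).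
  by move=> Jx; have [xI _ _ _ /H4[_ _ _ + _]] := JP x Jx; exact.
pose K := `|a| + e2; have K0 : 0 <= K := addr_ge0 (normr_ge0 a) (ltW e20).
have ulip1 y z : J y -> J z -> `|u z - u y| <= K * `|z - y| + rho * `|u (h z) - u (h y)|.
  move=> Jy Jz; rewrite (Ju z Jz) (Ju y Jy).
  have := H2 _ _ (JN y Jy).1 (JN z Jz).1; rewrite !pt0 !pt1 ptB.
  set w := N _ - N _; set D := z - y; set E := u (h z) - u (h y) => h1.
  have h2 := plane_norm_le (pt D E); rewrite pt0 pt1 in h2.
  have h3 := lerB_dist w (D * a + E * b).
  have h4 := ler_normD (D * a) (E * b); rewrite !normrM in h4.
  have h5 : e2 * `|pt D E| <= e2 * (`|D| + `|E|) by rewrite ler_pM2l.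
  have -> : rho = `|b| + e2 by rewrite /rho /e2; field.
  by rewrite /K; lra_using h1 h3 h4 h5.
(* [L] solves [K + rho * L = L]: a Lipschitz constant [L] for the image pair reproduces itself. *)
pose L := K / (1 - rho).
have L0 : 0 <= L by rewrite divr_ge0// subr_ge0 ltW.
have ulip y z : J y -> J z -> `|u z - u y| <= L * `|z - y|.
  move=> Jy Jz; rewrite leNgt; apply/negP => h1.
  (* Only continuity of [u] is known, so the Lipschitz bound is reached in the limit. Values on [J]
     lie within 1 of [u c], so their differences are at most 2, and each use of the equation damps
     this crude bound by [rho]. *)
  have ulipn n : forall v w, J v -> J w -> `|u w - u v| <= L * `|w - v| + rho ^+ n * 2.
    elim: n => [|n IH] v w Jv Jw.
      have [vI _ _ _ /H4[_ _ _ _ /(_ vI)[_ _ uv]]] := JP v Jv.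
      have [wI _ _ _ /H4[_ _ _ _ /(_ wI)[_ _ uw]]] := JP w Jw.
      have k1 := ler_normB (u w - u c) (u v - u c); rewrite opprB addrA subrK in k1.
      have k2 : 0 <= L * `|w - v| by rewrite mulr_ge0.
      by rewrite expr0; lra_using uv uw k1 k2.
    apply: le_trans (ulip1 v w Jv Jw) _.
    have := IH _ _ (hJ v Jv) (hJ w Jw); have [hl _] := hlip v w Jv Jw => h2.
    have h3 : L * `|h w - h v| <= L * `|w - v| by rewrite ler_wpM2l.
    have h4 : rho * `|u (h w) - u (h v)| <= rho * (L * `|w - v| + rho ^+ n * 2).
      by rewrite ler_wpM2l//; lra_using h2 h3.
    have h5 : K = L * (1 - rho) by rewrite /L divfK// subr_eq0 gt_eqF.
    by rewrite exprS h5; lra_using h2 h3 h4.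
  have [||n rn] := @expr_small _ rho ((`|u z - u y| - L * `|z - y|) / 2); [by []|lra_using h1|].
  by have k1 := ulipn n y z Jy Jz; lra_using rn k1.
have slip y z : J y -> J z -> y != z -> `|slope u y z| <= L.
  move=> Jy Jz yz; have := ulip y z Jy Jz; rewrite (slopeE _ yz) normrM mulrC.
  by rewrite ler_pM2r// normr_gt0 subr_eq0 eq_sym.
apply: (@extends_C1_contraction _ _ _ d _ h rho L) => //.
- move=> x Jx e e0; exists e => // y Jy; apply: le_lt_trans.
  by case: (hlip x y Jx Jy).
- move=> x y Jx Jy xy; rewrite -subr_eq0 -normr_gt0 distrC.
  have [_] := hlip x y Jx Jy; apply: lt_le_trans.
  by rewrite mulr_gt0// normr_gt0 subr_eq0 eq_sym.
move=> x Jx e e0.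
have [xI _ _ _ /H4[m1 Chx _ _ _]] := JP x Jx.
have [Nb CNx] := H3 _ (JN x Jx).2.
set m := 'D_1 h x in m1; set Px := pt x (u (h x)) in Nb CNx.
pose A0 := 'D_(pt 1 0) N Px; set B0 := 'D_(pt 0 1) N Px in Nb.
(* In [main] the expansion of [N] costs [e3 * (1 + L)] and that of [h] costs [e3 * L]; together they
   make [e3 * M]. *)
pose M := 2 * L + 1; have M0 : 0 < M by rewrite /M; lra_using L0.
pose e3 := e / (2 * M); have e30 : 0 < e3 by rewrite divr_gt0// mulr_gt0.
have [r1 r10 R1] : exists2 d : R, 0 < d &
    forall y z, `|y - x| < d -> `|z - x| < d ->
    `|h z - h y - (z - y) * m| <= e3 * `|z - y|.
  by case: Chx => A [oA Ax] Chx; exact: strict_approx_line oA Chx Ax e30.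
have [r2 r20 R2] : exists2 d : R, 0 < d & forall q q', `|q - Px| < d -> `|q' - Px| < d ->
    `|N q' - N q - ((q' 0 0 - q 0 0) * A0 + (q' 0 1 - q 0 1) * B0)| <= e3 * `|q' - q|.
  by case: CNx => A [oA AP] CNx; exact: strict_approx_plane oA CNx AP e30.
have L10 : 0 < L + 1 by exact: ltr_wpDl.
pose r := Num.min r1 (r2 / (L + 1)).
have r0 : 0 < r by rewrite lt_min r10 divr_gt0.
have rP y : J y -> `|y - x| < r -> `|y - x| < r1 /\ `|pt y (u (h y)) - Px| < r2.
  move=> Jy; rewrite lt_min ltr_pdivlMr// => /andP[yr1 yr2]; split=> //.
  have k1 : L * `|h y - h x| <= L * `|y - x|.
    by rewrite ler_wpM2l//; case: (hlip x y Jx Jy).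
  have k2 := ulip _ _ (hJ x Jx) (hJ y Jy); have k3 := normr_ge0 (y - x).
  have k4 : 0 <= L * `|y - x| by exact: mulr_ge0.
  by rewrite /Px ptB; apply: plane_norm_lt; rewrite ?pt0 ?pt1; lra_using yr2 k1 k2 k3 k4.
have main y z : near_pair J x r y z ->
    `|slope u y z - (A0 + B0 * m * slope u (h y) (h z))| <= e / 2.
  move=> [Jy Jz yz /(rP y Jy)[yr1 yr2] /(rP z Jz)[zr1 zr2]].
  have hyz : h y != h z.
    rewrite -subr_eq0 -normr_gt0 distrC; have [_] := hlip y z Jy Jz.
    by apply: lt_le_trans; rewrite mulr_gt0// normr_gt0 subr_eq0 eq_sym.
  have := R2 _ _ yr2 zr2; rewrite !pt0 !pt1 ptB -(Ju y Jy) -(Ju z Jz).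
  have := R1 y z yr1 zr1; have := (hlip y z Jy Jz).1.
  rewrite (slopeE u yz) (slopeE u hyz).
  have sL : `|slope u (h y) (h z)| <= L by apply: slip => //; exact: hJ.
  have yz0 : 0 < `|z - y| by rewrite normr_gt0 subr_eq0 eq_sym.
  set D := z - y in yz0 *; set s := slope u y z; set s' := slope u (h y) (h z) in sL *.
  set H := h z - h y => HD h1 h2.
  rewrite -(ler_pM2l yz0) -normrM.
  have -> : D * (s - (A0 + B0 * m * s')) =
    (D * s - (D * A0 + H * s' * B0)) + (H - D * m) * (s' * B0) by ring.
  apply: le_trans (ler_normD _ _) _.
  have n1 : `|pt D (H * s')| <= `|D| * (1 + L).
    apply: le_trans (plane_norm_le _) _; rewrite pt0 pt1 mulrDr mulr1 lerD2l normrM.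
    by apply: ler_pM.
  have n2 : `|(H - D * m) * (s' * B0)| <= e3 * `|D| * L.
    rewrite normrM; apply: ler_pM => //; rewrite normrM -[leRHS]mulr1.
    apply: ler_pM; [exact: normr_ge0|exact: normr_ge0|exact: sL|].
    by lra_using Nb rho1.
  have n3 : e3 * `|pt D (H * s')| <= e3 * (`|D| * (1 + L)) by rewrite ler_pM2l.
  have -> : e / 2 = e3 * M.
    by rewrite /e3 invfM mulrA divfK// gt_eqF.
  by rewrite /M; lra_using h2 n2 n3.
exists r => // y z y' z' p p'.
have := main y z p; have := main y' z' p'.
set s := slope u y z; set s1 := slope u y' z'.
set t := slope u (h y) (h z); set t1 := slope u (h y') (h z') => h1 h2.
have -> : s - s1 = B0 * m * (t - t1) +
  ((s - (A0 + B0 * m * t)) - (s1 - (A0 + B0 * m * t1))) by ring.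
apply: le_trans (ler_normD _ _) _; apply: lerD.
  rewrite !normrM ler_wpM2r// -[leRHS]mulr1; exact: ler_pM.
by apply: le_trans (ler_normB _ _) _; lra_using h1 h2.
Unshelve. all: by end_near. Qed.

End FunctionalEquation.

Section FunctionalEquationCk.
Context {R : realType} (I : interval R) (c : R).
Context (I_nondegenerate : exists a b, [/\ a \in I, b \in I & a < b]).
Context (cI : c \in I).
Context (h : R -> R).
Context (hc : h c = c).
Context (hI : \forall x \near c, x \in I -> h x \in I).
Context (h1 : Ck_at 1 c h).
Context (dh0 : 0 < `|'D_1 h c|).
Context (dh1 : `|'D_1 h c| < 1).

(* Differentiating u(x) = N(x, u(h x)) gives an equation of the same kind for
   u', namely u'(x) = N_x + N_t h'(x) u'(h x), whose contraction factor at c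
   is again less than 1; this drives an induction on k. *)
Lemma extends_Ck_functional k : Ck_at k c h -> forall (N : plane R -> R) (u : R -> R),
  Ck_at k (pt c (u c)) N -> `|'D_(pt 0 1) N (pt c (u c))| < 1 ->
  extends_Ck 0 [set` I] u c ->
  (\forall x \near c, x \in I -> u x = N (pt x (u (h x)))) ->
  extends_Ck k [set` I] u c.
Proof.
elim: k => [//|k IH] Ch N u CN b1 u0 uN.
have CN1 : Ck_at 1 (pt c (u c)) N by exact: Ck_at_le CN.
have [F EF] := extends_C1_functional I_nondegenerate cI hc hI h1 dh0 dh1 CN1 b1 u0 uN.
have Chk : Ck_at k c h by exact: Ck_at_le Ch.
have [G EG] := IH Chk N u (Ck_at_le (leqnSn k) CN) b1 u0 uN.
have [CF Fu] := (Ck_extensionP _ _ _ _ _).1 EF.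
have [CG Gu] := (Ck_extensionP _ _ _ _ _).1 EG.
have Gc : G c = u c by exact: (nbhs_singleton Gu).
have Fc : F c = u c by exact: (nbhs_singleton Fu).
apply: (extends_Ck_derivative cI EF).
pose v := 'D_1 F.
(* Two extensions of [u] are in play: [F] is C^1 and can be differentiated even when [k] is 0, while
   [G] has the class C^k that the coefficients of the differentiated equation need. *)
pose base (q : plane R) : plane R := pt (q 0 0) (G (h (q 0 0))).
pose N' (q : plane R) : R := 'D_(pt 1 0) N (base q) +
  ('D_(pt 0 1) N (base q) * 'D_1 h (q 0 0)) * q 0 1.
have base_c t : base (pt c t) = pt c (u c) by rewrite /base !pt0 hc Gc.
have Cfst t : Ck_at k (pt c t) (fun q : plane R => q 0 0).
  exact: (Ck_at_coord 0 (@Ck_at_id _ _ k (pt c t))).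
have Chf t : Ck_at k (pt c t) (fun q : plane R => h (q 0 0)).
  by apply: Ck_at_comp (Cfst t) _; rewrite pt0.
have Cbase t : Ck_at k (pt c t) base.
  apply: Ck_at_pt (Cfst t) _.
  by apply: (Ck_at_comp (g := G) (Chf t)); rewrite pt0 hc.
have CN' t : Ck_at k (pt c t) N'.
  apply: Ck_atD.
    by apply: (Ck_at_comp_plane (g := 'D_(pt 1 0) N) (Cbase t)); rewrite base_c; exact: Ck_at_derive CN.
  apply: Ck_atM; last exact: (Ck_at_coord 1 (@Ck_at_id _ _ k (pt c t))).
  apply: Ck_atM.
    by apply: (Ck_at_comp_plane (g := 'D_(pt 0 1) N) (Cbase t)); rewrite base_c; exact: Ck_at_derive CN.
  by apply: (Ck_at_comp (g := 'D_1 h) (Cfst t)); rewrite pt0; exact: Ck_at_derive Ch.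
apply: (IH Chk N' v).
- exact: CN'.
- rewrite derive_vertical !pt0 !pt1.
  have -> : (fun t : R => N' (pt c t)) = (fun t : R =>
      'D_(pt 1 0) N (pt c (u c)) + ('D_(pt 0 1) N (pt c (u c)) * 'D_1 h c) * t).
    by apply/funext => t; rewrite /N' base_c pt0 pt1.
  rewrite (_ : 'D_(1 : R) _ _ = 'D_(pt 0 1) N (pt c (u c)) * 'D_1 h c); last first.
    apply: derive_val; apply: is_derive_eq; rewrite /GRing.scale /=; ring.
  by rewrite normrM; apply: le_lt_trans dh1; rewrite ler_piMl// ltW.
- exists v; apply/Ck_extensionP; split; last by near=> x.
  exact: Ck_at_derive CF.
have Cgraph : Ck_at 1 c (fun x => pt x (F (h x))).
  apply: Ck_at_pt (@Ck_at_id _ _ 1 c) _.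
  by apply: Ck_at_comp h1 _; rewrite hc.
have nI : \forall x \near c, x \in I -> h x \in I /\ F (h x) = u (h x) /\ G (h x) = u (h x).
  have ch := Ck_at_continuous h1; rewrite /prop_for /continuous_at hc in ch.
  have Fh : \forall x \near c, h x \in I -> F (h x) = u (h x) by exact: ch Fu.
  have Gh : \forall x \near c, h x \in I -> G (h x) = u (h x) by exact: ch Gu.
  near=> x => xI.
  have hxI : h x \in I by move: xI; near: x.
  by split=> //; split; move: hxI; near: x.
have FN : \forall x \near c, x \in I -> F x = N (pt x (F (h x))).
  near=> x => xI.
  have Fx : F x = u x by move: xI; near: x.
  have [_ [Fhx _]] : h x \in I /\ F (h x) = u (h x) /\ G (h x) = u (h x).
    by move: xI; near: x.
  by rewrite Fx Fhx; move: xI; near: x.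
have nF := Ck_at_sub CF; have nh := Ck_at_sub h1.
have nFh : \forall x \near c, Ck_at 1 (h x) F.
  have ch := Ck_at_continuous h1; rewrite /prop_for /continuous_at hc in ch.
  exact: (ch _ (Ck_at_sub CF)).
have nN : \forall x \near c, Ck_at 1 (pt x (F (h x))) N.
  have cg := Ck_at_continuous Cgraph; rewrite /prop_for /continuous_at hc Fc in cg.
  exact: (cg _ (Ck_at_sub CN1)).
apply: filterS3 nI (nbhs_interior FN) (filterI (filterI nF nh) (filterI nFh nN)).
move=> x + nFN [[CFx Chx] [CFhx CNx]] xI.
move=> /(_ xI)[hxI [Fhx Ghx]].
have dFx : derivable F x 1 by apply: diff_derivable; exact: Ck_at_differentiable CFx.
have dhx : derivable h x 1 by apply: diff_derivable; exact: Ck_at_differentiable Chx.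
have dFhx : derivable F (h x) 1 by apply: diff_derivable; exact: Ck_at_differentiable CFhx.
have [dFh dE] := is_derive_line_comp dhx dFhx.
have [r r0 Hr] : exists2 r : R, 0 < r &
    forall y, `|y - x| < r -> y \in I -> F y = N (pt y (F (h y))).
  exact/nearP.
have dN := is_derive_graph (a := F \o h) dFh (Ck_at_differentiable CNx).
have -> : N' (pt x (v (h x))) = 'D_(pt 1 0) N (pt x (F (h x))) +
    'D_1 (F \o h) x * 'D_(pt 0 1) N (pt x (F (h x))).
  by rewrite /N' /v /base !pt0 !pt1 Ghx -Fhx dE; ring.
(* The equation for [F] holds on [I] only, so its two sides are differentiated within [I] and the
   results identified by uniqueness. *)
apply: (@derivative_within_unique _ [set` I] F x).
- exact: itv_clusters_at.
- exact: is_derive_within (DeriveDef dFx erefl).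
apply: (@derivative_within_near _ [set` I] _ (fun y => N (pt y (F (h y)))) _ _ _ r) => //.
- by apply/esym/Hr => //; rewrite subrr normr0.
- by move=> y yI yr; split=> //; exact/esym/Hr.
exact: is_derive_within dN.
Unshelve. all: by end_near. Qed.

End FunctionalEquationCk.

(** * The invariant curve near the fixed point *)

(** The function being differentiated is the inverse of the action of the Jacobian on slopes: a
    vector of slope [(t * a - a') / (b' - t * b)] is sent to one of slope [t]. The numerator of the
    derivative simplifies to the determinant, so at the slope of the eigenvector for [lam] the value
    is [lam / mu]. *)
Lemma derive_mobius (R : realType) (a a' b b' s : R) : b' - s * b != 0 ->
  'D_(1 : R) (fun t : R => (t * a - a') * (b' - t * b)^-1) s =
  (a * (b' - s * b) + (s * a - a') * b) / (b' - s * b) ^+ 2.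
Proof.
move=> dn0; pose num (t : R) := t * a - a'; pose den (t : R) := b' - t * b.
have dnum : is_derive s (1 : R) num a.
  by apply: is_derive_eq; rewrite /GRing.scale /=; ring.
have dden : is_derive s (1 : R) den (- b).
  by apply: is_derive_eq; rewrite /GRing.scale /=; ring.
have dnum' : derivable num s (1 : R) by exact: ex_derive.
have dden' : derivable den s (1 : R) by exact: ex_derive.
have dinv : derivable (fun t => (den t)^-1) s 1 by exact: derivableV.
have nE : 'D_1 num s = a by exact: derive_val.
have dE : 'D_1 den s = - b by exact: derive_val.
have dVE : 'D_1 (fun t => (den t)^-1) s = - den s ^- 2 *: 'D_1 den s.
  exact: (deriveV (f := den) dn0 dden').
rewrite (deriveM dnum' dinv : 'D_1 (fun t => num t * (den t)^-1) s = _).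
rewrite dVE nE dE /num /den /GRing.scale /=.
by field.
Qed.

Section StableCurve.
Context {R : realType} (I : interval R) (c : R).
Context (I_nondegenerate : exists a b, [/\ a \in I, b \in I & a < b]).
Context (cI : c \in I).
Context (phi : R -> R) (g0 g1 : plane R -> R) (lam mu s : R).
Let P := pt c (phi c).
Let a := 'D_(pt 1 0) g0 P.
Let b := 'D_(pt 0 1) g0 P.
Let a' := 'D_(pt 1 0) g1 P.
Let b' := 'D_(pt 0 1) g1 P.
Let h x := g0 (pt x (phi x)).
Context (hc : h c = c).
Context (Cg0 : Ck_at 1 P g0).
Context (Cg1 : Ck_at 1 P g1).
Context (lam0 : 0 < `|lam|).
Context (lam_mu : `|lam| < mu).
Context (lam1 : `|lam| < 1).
(* (1, s) is an eigenvector for lam and (u, v) |-> v - s u a left eigenvector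
   for mu. *)
Context (eig_lam0 : a + b * s = lam).
Context (eig_lam1 : a' + b' * s = lam * s).
Context (eig_mu : b' - b * s = mu).
Context (phi_cont : forall x, x \in I -> forall eps, 0 < eps ->
  exists2 r : R, 0 < r & forall y, y \in I -> `|y - x| < r -> `|phi y - phi x| < eps).
Context (phi_invariant : \forall x \near c, x \in I ->
  h x \in I /\ phi (h x) = g1 (pt x (phi x))).
Context (phi_tangent : forall eta, 0 < eta ->
  \forall x \near c, x \in I -> `|phi x - phi c - (x - c) * s| <= eta * `|x - c|).

Tactic Notation "lra_from" hyp_list(l) :=
  clear - l I_nondegenerate cI hc Cg0 Cg1 lam0 lam_mu lam1 eig_lam0 eig_lam1
    eig_mu phi_cont phi_invariant phi_tangent; lra.

(* A pair of points of the curve whose difference leaves the cone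
   |v - s u| <= eta |u| is expanded transversally at a rate close to mu, which
   is impossible since both orbits tend to the fixed point at a rate close to
   |lam| < mu. *)
Lemma graph_dynamics (eta r0 : R) : 0 < eta -> 0 < r0 ->
  exists2 r : R, 0 < r <= r0 & let J := [set x | x \in I /\ `|x - c| < r] in
  [/\ forall x, J x -> J (h x) /\ phi (h x) = g1 (pt x (phi x)),
      forall y z, J y -> J z -> `|phi z - phi y - (z - y) * s| <= eta * `|z - y| &
      forall y z, J y -> J z ->
        `|lam| / 2 * `|z - y| <= `|h z - h y| /\ `|h z - h y| <= `|z - y|].
Proof.
move=> eta0 r00.
(* The margin [g] separates the rates: orbits approach [c] at a rate at most |lam| + [g],
   transversal parts expand at a rate at least [mu - g], and the former is less than both the latter
   and 1. *)
have [g [g_gt0 g_lam g_mu g_1]] : exists g, [/\ 0 < g, g <= `|lam| / 4,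
    4 * g <= mu - `|lam| & 4 * g <= 1 - `|lam|].
  exists (Num.min `|lam| (Num.min (mu - `|lam|) (1 - `|lam|)) / 4).
  set m := Num.min _ _.
  have m0 : 0 < m by rewrite !lt_min lam0 !subr_gt0 lam_mu.
  have m1 : m <= `|lam| by rewrite ge_min lexx.
  have m2 : m <= mu - `|lam| by rewrite /m !ge_min lexx orbT.
  have m3 : m <= 1 - `|lam| by rewrite /m !ge_min lexx !orbT.
  by split; lra.
have b0 := normr_ge0 b.
have b10 : 0 < `|b| + 1 by lra.
(* Within the cone of aperture [e] the transversal part of a chord adds at most [g / 2] times its
   horizontal part to the first coordinate of the image. *)
pose e := Num.min eta (g / (2 * (`|b| + 1))).
have e_gt0 : 0 < e by rewrite lt_min eta0 divr_gt0// mulr_gt0.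
have e_eta : e <= eta by rewrite ge_min lexx.
have e_g : e * (`|b| + 1) <= g / 2.
  have : e <= g / (2 * (`|b| + 1)) by rewrite ge_min lexx orbT.
  by rewrite ler_pdivlMr ?mulr_gt0//; lra.
have eb0 : 0 <= e * `|b| by rewrite mulr_ge0// ltW.
have e_g' : e <= g / 2 by lra.
have g1_8 : g <= 1 / 4 by have := normr_ge0 lam; lra.
pose E := g * e / 4; have E_gt0 : 0 < E by rewrite /E divr_gt0// mulr_gt0.
have Ee : E <= g / 4 by rewrite /E; have := ler_wpM2l (ltW g_gt0) e_g'; nra.
pose S := 1 + `|s|; have S_ge1 : 1 <= S by rewrite /S; have := normr_ge0 s; lra.
have S0 : 0 < S by lra.
(* One factor [S] bounds a chord by [z - y] and the transversal part; the other comes from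
   recombining the two image coordinates into the transversal part of the image. *)
pose eps := E / (S * S); have eps0 : 0 < eps by rewrite divr_gt0// mulr_gt0.
have [d0 d00 H0] : exists2 d : R, 0 < d & forall q q', `|q - P| < d -> `|q' - P| < d ->
    `|g0 q' - g0 q - ((q' 0 0 - q 0 0) * a + (q' 0 1 - q 0 1) * b)| <= eps * `|q' - q|.
  by case: Cg0 => A [oA AP] Cg; exact: strict_approx_plane oA Cg AP eps0.
have [d1 d10 H1] : exists2 d : R, 0 < d & forall q q', `|q - P| < d -> `|q' - P| < d ->
    `|g1 q' - g1 q - ((q' 0 0 - q 0 0) * a' + (q' 0 1 - q 0 1) * b')| <= eps * `|q' - q|.
  by case: Cg1 => A [oA AP] Cg; exact: strict_approx_plane oA Cg AP eps0.
have [d2 d20 H2] : exists2 d : R, 0 < d & forall x, `|x - c| < d -> x \in I ->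
    [/\ h x \in I, phi (h x) = g1 (pt x (phi x)) &
        `|phi x - phi c - (x - c) * s| <= e * `|x - c|].
  apply/nearP; apply: filterS2 phi_invariant (phi_tangent e_gt0) => x h1 h2 xI.
  by have [? ?] := h1 xI; split=> //; exact: h2.
have [d3 d30 H3] : exists2 d : R, 0 < d & forall x, x \in I -> `|x - c| < d ->
    `|phi x - phi c| < Num.min d0 d1.
  by have [|d d_gt0 Hd] := phi_cont cI (eps := Num.min d0 d1); [rewrite lt_min d00|exists d].
pose r := Num.min (Num.min r0 (Num.min d0 d1)) (Num.min d2 d3).
have r_gt0 : 0 < r by rewrite /r !lt_min r00 d00 d10 d20 d30.
exists r; first by rewrite r_gt0 /r !ge_min lexx.
set J := [set x | _].
have JP x : J x -> [/\ x \in I, `|x - c| < d2, `|pt x (phi x) - P| < d0 & `|pt x (phi x) - P| < d1].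
  move=> [xI]; rewrite /r !lt_min => /andP[/andP[_ /andP[xd0 xd1]] /andP[xd2 xd3]].
  have := H3 x xI xd3; rewrite lt_min => /andP[p0 p1].
  by split=> //; rewrite /P ptB; apply: plane_norm_lt; rewrite ?pt0 ?pt1.
(* [Z y z] is the left eigenvector for [mu] applied to the chord. In the coordinates
   [(z - y, Z y z)] the Jacobian is triangular, with diagonal [lam], [mu] and [b] as its only
   coupling. *)
pose Z y z := phi z - phi y - (z - y) * s.
have Zdiff y z : J y -> J z -> `|pt z (phi z) - pt y (phi y)| <= S * (`|z - y| + `|Z y z|).
  move=> _ _; apply: le_trans (plane_norm_le _) _; rewrite ptB pt0 pt1.
  have -> : phi z - phi y = Z y z + (z - y) * s by rewrite /Z subrK.
  have k1 := ler_normD (Z y z) ((z - y) * s); rewrite normrM in k1.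
  have k2 : 0 <= `|s| * `|Z y z| by exact: mulr_ge0.
  by rewrite /S; lra_from k1 k2.
have lin0 y z : J y -> J z ->
    `|h z - h y - ((z - y) * lam + Z y z * b)| <= E * (`|z - y| + `|Z y z|).
  move=> Jy Jz; have [_ _ y0 _] := JP y Jy; have [_ _ z0 _] := JP z Jz.
  have := H0 _ _ y0 z0; rewrite !pt0 !pt1.
  have -> : (z - y) * a + (phi z - phi y) * b = (z - y) * lam + Z y z * b.
    by rewrite /Z -eig_lam0; ring.
  move=> /le_trans; apply.
  have : eps * `|pt z (phi z) - pt y (phi y)| <= eps * (S * (`|z - y| + `|Z y z|)).
    by rewrite ler_pM2l//; exact: Zdiff.
  move=> /le_trans; apply; rewrite mulrA ler_wpM2r ?addr_ge0//.
  rewrite /eps invfM mulrA divfK ?gt_eqF// ler_pdivrMr//.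
  by rewrite -[leLHS]mulr1 ler_pM2l.
have lin1 y z : J y -> J z -> `|Z (h y) (h z) - mu * Z y z| <= E * (`|z - y| + `|Z y z|).
  move=> Jy Jz; have [yI yd y0 y1] := JP y Jy; have [zI zd z0 z1] := JP z Jz.
  have [_ phy _] := H2 y yd yI; have [_ phz _] := H2 z zd zI.
  have := H0 _ _ y0 z0; have := H1 _ _ y1 z1; rewrite !pt0 !pt1.
  have := Zdiff y z Jy Jz.
  set N := `|pt z (phi z) - pt y (phi y)| => hN k1 k0.
  have -> : Z (h y) (h z) - mu * Z y z =
      (g1 (pt z (phi z)) - g1 (pt y (phi y)) - ((z - y) * a' + (phi z - phi y) * b')) -
      (g0 (pt z (phi z)) - g0 (pt y (phi y)) - ((z - y) * a + (phi z - phi y) * b)) * s.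
    rewrite /Z phy phz -/(h y) -/(h z) -eig_mu.
    have -> : a' = (a + b * s) * s - b' * s by rewrite eig_lam0 -eig_lam1; ring.
    by ring.
  apply: le_trans (ler_normB _ _) _; rewrite normrM.
  apply: (@le_trans _ _ (eps * S * N)).
    have k3 := ler_wpM2r (normr_ge0 s) k0; rewrite /S; lra_from k1 k3.
  have -> : E = eps * S * S by rewrite /eps -mulrA divfK// gt_eqF// mulr_gt0.
  have eS : 0 < eps * S by exact: mulr_gt0.
  by rewrite -[leRHS]mulrA ler_pM2l.
have Jc : J c by split; rewrite // subrr normr0.
have tang x : J x -> `|Z c x| <= e * `|x - c|.
  by move=> /JP[xI xd _ _]; have [_ _] := H2 x xd xI.
(* For chords starting at the fixed point the cone estimate is the tangency itself, so the rate of
   approach is available before the general cone estimate. *)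
have decay x : J x -> `|h x - c| <= (`|lam| + g) * `|x - c|.
  move=> Jx; have := lin0 c x Jc Jx; rewrite hc => k0.
  have := tang x Jx => k1; set D := x - c in k0 k1 *.
  have k5 := lerB_dist (h x - c) (D * lam + Z c x * b).
  have k6 := ler_normD (D * lam) (Z c x * b); rewrite !normrM in k6.
  have k2 : `|Z c x| * `|b| <= e * `|D| * `|b| by rewrite ler_wpM2r.
  have k3' : `|Z c x| <= `|D|.
    by apply: le_trans k1 _; rewrite -[leRHS]mul1r ler_wpM2r//; lra_from e_g' g1_8.
  have k3 : E * (`|D| + `|Z c x|) <= g / 4 * (`|D| + `|D|).
    apply: (@le_trans _ _ (g / 4 * (`|D| + `|Z c x|))).
      by rewrite ler_wpM2r// addr_ge0.
    by rewrite ler_pM2l ?divr_gt0// lerD2l.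
  have k4 : e * `|b| * `|D| <= g / 2 * `|D|.
    by rewrite ler_wpM2r//; lra_from e_g e_gt0.
  by lra_from k0 k2 k3 k4 k5 k6.
have hJ x : J x -> J (h x).
  move=> Jx; have [xI xd _ _] := JP x Jx; have [hxI _ _] := H2 x xd xI; split=> //.
  case: (Jx) => _; apply: le_lt_trans; apply: le_trans (decay x Jx) _.
  by rewrite -[leRHS]mul1r ler_wpM2r//; lra_from g_1 g_gt0.
pose nu := mu - g; have nu0 : 0 < nu by rewrite /nu; have := normr_ge0 lam; lra_from g_gt0 g_mu.
have growth y z : J y -> J z -> e * `|z - y| < `|Z y z| ->
    nu * `|Z y z| <= `|Z (h y) (h z)| /\ e * `|h z - h y| < `|Z (h y) (h z)|.
  move=> Jy Jz; have := lin0 y z Jy Jz; have := lin1 y z Jy Jz.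
  set D := z - y; set W := Z y z; set W1 := Z _ _; set D1 := h z - h y => k1 k0 k.
  have W0 : 0 < `|W| by apply: le_lt_trans k; rewrite mulr_ge0// ltW.
  have k2 : E * (`|D| + `|W|) <= g / 2 * `|W|.
    have k4 : g / 4 * (e * `|D|) <= g / 4 * `|W| by rewrite ler_wpM2l ?ltW// divr_gt0.
    have k5 : E * `|W| <= g / 4 * `|W| by rewrite ler_wpM2r.
    have -> : E * (`|D| + `|W|) = g / 4 * (e * `|D|) + E * `|W| by rewrite /E; ring.
    by lra_from k4 k5.
  have mu_gt0 : 0 < mu by exact: le_lt_trans lam_mu.
  have k3 : nu * `|W| <= `|W1|.
    have k4 := lerB_dist (mu * W) W1; rewrite distrC normrM (gtr0_norm mu_gt0) in k4.
    have k5 : 0 < g * `|W| by exact: mulr_gt0.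
    by rewrite /nu; lra_from k1 k2 k4 k5.
  split=> //; apply: lt_le_trans k3.
  have k4 := ler_normD (D * lam) (W * b); rewrite !normrM in k4.
  have k5 := lerB_dist D1 (D * lam + W * b).
  have k6 : `|D1| <= `|D| * `|lam| + `|W| * `|b| + g / 2 * `|W|.
    by lra_from k0 k2 k4 k5.
  have k7 : e * `|D1| <= e * (`|D| * `|lam| + `|W| * `|b| + g / 2 * `|W|) by rewrite ler_pM2l.
  have k8 : e * `|D| * `|lam| <= `|W| * `|lam| by rewrite ler_wpM2r// ltW.
  have k9 : e * `|b| * `|W| <= g / 2 * `|W| by rewrite ler_wpM2r//; lra_from e_g e_gt0.
  have k10 : e * (g / 2 * `|W|) <= 1 * (g / 2 * `|W|).
    by rewrite ler_wpM2r ?mulr_ge0 ?divr_ge0 ?ltW//; lra_from e_g' g1_8.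
  have k11 : 0 < (mu - g - `|lam| - g) * `|W| by rewrite mulr_gt0//; lra_from g_gt0 g_mu.
  by rewrite /nu; lra_from k7 k8 k9 k10 k11.
have cone y z : J y -> J z -> `|Z y z| <= e * `|z - y|.
  move=> Jy Jz; rewrite leNgt; apply/negP => k.
  (* Tangency bounds the transversal part of any pair by [e] times the distances to [c]. Applied to
     the [n]-th images, it bounds something that has grown by [nu ^+ n] by something that has shrunk
     by the [n]-th power of |lam| + [g]. *)
  have claim n : forall v w, J v -> J w -> e * `|w - v| < `|Z v w| ->
      nu ^+ n * `|Z v w| <= (`|lam| + g) ^+ n * (e * (`|v - c| + `|w - c|)).
    elim: n => [|n IH] v w Jv Jw kvw.
      rewrite !expr0 !mul1r mulrDr.
      have -> : Z v w = Z c w - Z c v by rewrite /Z; ring.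
      by apply: le_trans (ler_normB _ _) _; rewrite addrC; apply: lerD; exact: tang.
    have [g1' g2'] := growth v w Jv Jw kvw.
    have k1 := IH _ _ (hJ v Jv) (hJ w Jw) g2'.
    have -> : nu ^+ n.+1 * `|Z v w| = nu ^+ n * (nu * `|Z v w|) by rewrite exprS; ring.
    have k2 : nu ^+ n * (nu * `|Z v w|) <= nu ^+ n * `|Z (h v) (h w)|.
      by rewrite ler_pM2l// exprn_gt0.
    apply: le_trans k2 _; apply: le_trans k1 _.
    have -> : (`|lam| + g) ^+ n.+1 * (e * (`|v - c| + `|w - c|)) =
      (`|lam| + g) ^+ n * (e * ((`|lam| + g) * `|v - c| + (`|lam| + g) * `|w - c|)).
      by rewrite exprS; ring.
    rewrite ler_pM2l ?exprn_gt0 ?ler_pM2l//; last by have := normr_ge0 lam; lra_from g_gt0.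
    by apply: lerD; exact: decay.
  have W0 : 0 < `|Z y z| by apply: le_lt_trans k; rewrite mulr_ge0// ltW.
  have B0 : 0 < e * (`|y - c| + `|z - c|) + 1.
    by rewrite ltr_wpDl// mulr_ge0 ?addr_ge0// ltW.
  have q01 : 0 <= (`|lam| + g) / nu < 1.
    have k2 : 0 <= `|lam| + g by have := normr_ge0 lam; lra_from g_gt0.
    by rewrite divr_ge0 ?(ltW nu0)//= ltr_pdivrMr// /nu; lra_from g_gt0 g_mu.
  have [n] := expr_small q01 (divr_gt0 W0 B0).
  rewrite ltr_pdivlMr// expr_div_n mulrAC ltr_pdivrMr ?exprn_gt0// mulrDr mulr1.
  have k2 : 0 < (`|lam| + g) ^+ n by apply: exprn_gt0; have := normr_ge0 lam; lra_from g_gt0.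
  have k3 := claim n y z Jy Jz k; rewrite [nu ^+ n * _]mulrC in k3.
  by lra_from k2 k3.
split.
- move=> x Jx; split; first exact: hJ.
  by have [xI xd _ _] := JP x Jx; have [] := H2 x xd xI.
- by move=> y z Jy Jz; apply: le_trans (cone y z Jy Jz) _; rewrite ler_wpM2r.
move=> y z Jy Jz; have := lin0 y z Jy Jz; have k1 := cone y z Jy Jz.
set D := z - y in k1 *; set W := Z y z in k1 *; set D1 := h z - h y => k0.
have k7 := lerB_dist D1 (D * lam + W * b).
have k8 := lerB_dist (D * lam + W * b) D1; rewrite [`|_ - D1|]distrC in k8.
have k9 := ler_normD (D * lam) (W * b); rewrite !normrM in k9.
have k9' := lerB_normD (D * lam) (W * b); rewrite !normrM in k9'.
have k2 : `|W| * `|b| <= e * `|D| * `|b| by rewrite ler_wpM2r.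
have k3' : `|W| <= `|D|.
  by apply: le_trans k1 _; rewrite -[leRHS]mul1r ler_wpM2r//; lra_from e_g' g1_8.
have k3 : E * (`|D| + `|W|) <= g / 4 * (`|D| + `|D|).
  apply: (@le_trans _ _ (g / 4 * (`|D| + `|W|))).
    by rewrite ler_wpM2r// addr_ge0.
  by rewrite ler_pM2l ?divr_gt0// lerD2l.
have k4 : e * `|b| * `|D| <= g / 2 * `|D|.
  by rewrite ler_wpM2r//; lra_from e_g e_gt0.
have k5 : g * `|D| <= `|lam| / 4 * `|D| by rewrite ler_wpM2r.
have k6 : (4 * g) * `|D| <= (1 - `|lam|) * `|D| by rewrite ler_wpM2r.
have k10 := normr_ge0 D.
by split; lra_from g_gt0 g_lam k0 k2 k3 k4 k5 k6 k7 k8 k9 k9' k10.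
Qed.

(* For slopes t, w at nearby pairs, with images t', w', one has
   (b' - b t') (t - w) = (a + b w) (t' - w') + o(1), where b' - b t' is close
   to mu and a + b w is close to lam. *)
Lemma stable_curve_C1 : extends_Ck 1 [set` I] phi c.
Proof.
pose g := Num.min `|lam| (mu - `|lam|) / 4.
have g_gt0 : 0 < g by rewrite divr_gt0// lt_min lam0 subr_gt0.
have g_mu : 4 * g <= mu - `|lam|.
  have : Num.min `|lam| (mu - `|lam|) <= mu - `|lam| by rewrite ge_min lexx orbT.
  by rewrite /g; lra.
have b0 := normr_ge0 b; have s0 := normr_ge0 s.
pose eta := Num.min 1 (g / (2 * (`|b| + 1))).
have eta_gt0 : 0 < eta by rewrite lt_min ltr01 divr_gt0// mulr_gt0//; lra.
have eta1 : eta <= 1 by rewrite ge_min lexx.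
have eta_b : `|b| * eta <= g / 2.
  have : eta <= g / (2 * (`|b| + 1)) by rewrite ge_min lexx orbT.
  by rewrite ler_pdivlMr ?mulr_gt0//; lra.
pose B := `|s| + 1; have B1 : 1 <= B by rewrite /B; lra.
(* The bound [e * (B + 1) = g / 2] is the cost of moving the partial derivatives away from the fixed
   point, and |b| [eta] <= [g / 2] that of replacing a slope by [s]. Together they turn |lam| and
   [mu] into [kap] and [nu]. *)
pose e := g / (2 * (B + 1)).
have e_gt0 : 0 < e by rewrite divr_gt0// mulr_gt0//; lra.
have eB : e * (B + 1) = g / 2 by rewrite /e; field; lra.
pose nu := mu - g; pose kap := `|lam| + g.
have nu0 : 0 < nu by rewrite /nu; have := normr_ge0 lam; lra.
have kap0 : 0 <= kap by rewrite /kap; have := normr_ge0 lam; lra.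
have [d d0 Hd] : exists2 d : R, 0 < d & forall x, x \in I -> `|x - c| < d ->
    let p := pt x (phi x) in
    [/\ Ck_at 1 p g0, Ck_at 1 p g1, `|'D_(pt 1 0) g0 p - a| <= e,
        `|'D_(pt 0 1) g0 p - b| <= e & `|'D_(pt 0 1) g1 p - b'| <= e].
  have [d d0 Hd] : exists2 d : R, 0 < d & forall p, `|p - P| < d ->
      [/\ Ck_at 1 p g0, Ck_at 1 p g1, `|'D_(pt 1 0) g0 p - a| <= e,
        `|'D_(pt 0 1) g0 p - b| <= e & `|'D_(pt 0 1) g1 p - b'| <= e].
    apply/nearP.
    have c1 := continuous_dist_lt (Ck_at_continuous (Ck_at_derive (pt 1 0) Cg0)) e_gt0.
    have c2 := continuous_dist_lt (Ck_at_continuous (Ck_at_derive (pt 0 1) Cg0)) e_gt0.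
    have c3 := continuous_dist_lt (Ck_at_continuous (Ck_at_derive (pt 0 1) Cg1)) e_gt0.
    apply: filterS2 (filterI (Ck_at_sub Cg0) (Ck_at_sub Cg1)) (filterI c1 (filterI c2 c3)).
    move=> p [C0 C1] [k1 [k2 k3]]; split; [exact C0|exact C1|..].
    - by rewrite distrC; exact: ltW k1.
    - by rewrite distrC; exact: ltW k2.
    - by rewrite distrC; exact: ltW k3.
  have [d' d'0 Hd'] := phi_cont cI d0.
  exists (Num.min d d'); first by rewrite lt_min d0.
  move=> x xI; rewrite lt_min => /andP[xd xd']; apply: Hd.
  by rewrite /P ptB; apply: plane_norm_lt; rewrite ?pt0 ?pt1//; exact: Hd'.
have [r /andP[r0 rd] [hJ cone hlip]] := graph_dynamics eta_gt0 d0.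
set J := [set x | _] in hJ cone hlip.
have slope_s y z : J y -> J z -> y != z -> `|slope phi y z - s| <= eta.
  move=> Jy Jz yz; have := cone y z Jy Jz; rewrite (slopeE _ yz) -mulrBr normrM mulrC.
  by rewrite ler_pM2r// normr_gt0 subr_eq0 eq_sym.
have slope_B y z : J y -> J z -> y != z -> `|slope phi y z| <= B.
  move=> Jy Jz yz; have := slope_s y z Jy Jz yz.
  by have := lerB_dist (slope phi y z) s; rewrite /B; lra.
have h_neq y z : J y -> J z -> y != z -> h y != h z.
  move=> Jy Jz yz; rewrite -subr_eq0 -normr_gt0 distrC.
  have [+ _] := hlip y z Jy Jz; apply: lt_le_trans.
  by rewrite mulr_gt0 ?divr_gt0// normr_gt0 subr_eq0 eq_sym.
have kn : 0 <= kap / nu < 1.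
  by rewrite divr_ge0 ?(ltW nu0)//= ltr_pdivrMr// /kap /nu; lra.
apply: (@extends_C1_contraction _ I c r phi h (kap / nu) B) => //.
- by move=> x /hJ[].
- move=> x Jx eps eps0; exists eps => // y Jy; apply: le_lt_trans.
  by case: (hlip x y Jx Jy).
move=> x Jx eps eps0.
have xd : `|x - c| < d by case: Jx => _ /lt_le_trans; exact.
have [Cx0 Cx1 ha hb hb'] := Hd x Jx.1 xd.
set p := pt x (phi x) in Cx0 Cx1 ha hb hb'.
pose Ax := 'D_(pt 1 0) g0 p; pose Bx := 'D_(pt 0 1) g0 p.
pose A'x := 'D_(pt 1 0) g1 p; pose B'x := 'D_(pt 0 1) g1 p.
(* The four error terms of [key] add up to [2 * (1 + B) * (1 + B) * eps3], which is [eps * nu]. *)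
pose eps3 := eps * nu / (2 * (1 + B) * (1 + B)).
have B10 : 0 < 1 + B by lra_from B1.
have eps30 : 0 < eps3 by rewrite divr_gt0 ?mulr_gt0.
have [d1 d10 H1] : exists2 d : R, 0 < d & forall q q', `|q - p| < d -> `|q' - p| < d ->
    `|g0 q' - g0 q - ((q' 0 0 - q 0 0) * Ax + (q' 0 1 - q 0 1) * Bx)| <= eps3 * `|q' - q|.
  by case: Cx0 => A [oA AP] Cg; exact: strict_approx_plane oA Cg AP eps30.
have [d2 d20 H2] : exists2 d : R, 0 < d & forall q q', `|q - p| < d -> `|q' - p| < d ->
    `|g1 q' - g1 q - ((q' 0 0 - q 0 0) * A'x + (q' 0 1 - q 0 1) * B'x)| <= eps3 * `|q' - q|.
  by case: Cx1 => A [oA AP] Cg; exact: strict_approx_plane oA Cg AP eps30.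
have [d3 d30 H3] : exists2 d : R, 0 < d & forall y, y \in I -> `|y - x| < d ->
    `|phi y - phi x| < Num.min d1 d2.
  by apply: phi_cont; [case: Jx|rewrite lt_min d10].
pose r' := Num.min (Num.min d1 d2) d3.
have r'0 : 0 < r' by rewrite /r' !lt_min d10 d20.
have r'P y : J y -> `|y - x| < r' -> `|pt y (phi y) - p| < d1 /\ `|pt y (phi y) - p| < d2.
  move=> Jy; rewrite /r' !lt_min => /andP[/andP[yd1 yd2] /(H3 y Jy.1)].
  by rewrite lt_min => /andP[? ?]; rewrite /p ptB; split; apply: plane_norm_lt; rewrite ?pt0 ?pt1.
(* Here [e1] and [e2] are the errors in the difference quotients of the two components of the map
   along the curve; the image slope is the quotient of the second by the first. *)
have main y z : near_pair J x r' y z -> let t := slope phi y z in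
    let t' := slope phi (h y) (h z) in
    [/\ `|Ax + Bx * t| <= kap, nu <= `|B'x - Bx * t'|, `|t'| <= B &
    exists e1 e2, [/\ (Ax + Bx * t + e1) * t' = A'x + B'x * t + e2,
      `|e1| <= eps3 * (1 + B) & `|e2| <= eps3 * (1 + B)]].
  move=> [Jy Jz yz yr zr] t t'.
  have [[Jhy phy] [Jhz phz]] := (hJ y Jy, hJ z Jz).
  have hyz := h_neq y z Jy Jz yz.
  have t1 : `|t - s| <= eta by exact: slope_s.
  have t2 : `|t' - s| <= eta by exact: slope_s.
  have tB : `|t| <= B by exact: slope_B.
  have tB' : `|t'| <= B by exact: slope_B.
  have [y1 y2] := r'P y Jy yr; have [z1 z2] := r'P z Jz zr.
  have bt u : `|u - s| <= eta -> `|b * (u - s)| <= g / 2.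
    by move=> us; rewrite normrM; apply: le_trans eta_b; rewrite ler_wpM2l.
  have bxt u : `|u| <= B -> `|(Bx - b) * u| <= e * B.
    by move=> uB; rewrite normrM; exact: ler_pM.
  split=> //.
  - have -> : Ax + Bx * t = lam + ((Ax - a) + (Bx - b) * t + b * (t - s)).
      by rewrite -eig_lam0; ring.
    apply: le_trans (ler_normD _ _) _; rewrite /kap lerD2l.
    apply: le_trans (ler_normD _ _) _.
    have k1 := ler_normD (Ax - a) ((Bx - b) * t); have k2 := bt t t1.
    by have k3 := bxt t tB; rewrite -/Ax in ha; lra_from ha eB k1 k2 k3.
  - have -> : B'x - Bx * t' = mu - ((b' - B'x) + (Bx - b) * t' + b * (t' - s)).
      by rewrite -eig_mu; ring.
    have mu0 : 0 < mu by exact: le_lt_trans lam_mu.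
    have k1 := lerB_dist mu ((b' - B'x) + (Bx - b) * t' + b * (t' - s)).
    rewrite (gtr0_norm mu0) in k1.
    have k2 := ler_normD (b' - B'x + (Bx - b) * t') (b * (t' - s)).
    have k3 := ler_normD (b' - B'x) ((Bx - b) * t').
    have k4 := bt t' t2; have k5 := bxt t' tB'.
    by rewrite -/B'x distrC in hb'; rewrite /nu; lra_from hb' eB k1 k2 k3 k4 k5.
  have yz0 : 0 < `|z - y| by rewrite normr_gt0 subr_eq0 eq_sym.
  have zy0 : z - y != 0 by rewrite -normr_gt0.
  have n1 : `|pt z (phi z) - pt y (phi y)| <= `|z - y| * (1 + B).
    apply: le_trans (plane_norm_le _) _; rewrite ptB pt0 pt1 (slopeE _ yz) normrM.
    by rewrite mulrDr mulr1 lerD2l ler_wpM2l.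
  exists ((h z - h y) / (z - y) - (Ax + Bx * t)).
  exists ((phi (h z) - phi (h y)) / (z - y) - (A'x + B'x * t)).
  have est g2 A2 B2 : `|g2 (pt z (phi z)) - g2 (pt y (phi y)) -
      ((z - y) * A2 + (phi z - phi y) * B2)| <= eps3 * `|pt z (phi z) - pt y (phi y)| ->
      `|(g2 (pt z (phi z)) - g2 (pt y (phi y))) / (z - y) - (A2 + B2 * t)| <= eps3 * (1 + B).
    move=> k1; rewrite -(ler_pM2l yz0) -normrM.
    have -> : (z - y) * ((g2 (pt z (phi z)) - g2 (pt y (phi y))) / (z - y) - (A2 + B2 * t)) =
       g2 (pt z (phi z)) - g2 (pt y (phi y)) - ((z - y) * A2 + (phi z - phi y) * B2).
      by rewrite (slopeE _ yz) -/t; field.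
    by apply: le_trans k1 _; rewrite mulrCA ler_pM2l.
  split.
  - rewrite [_ + (_ - _)]addrC subrK [RHS]addrC subrK (slopeE _ hyz) -/t'.
    by rewrite mulrAC.
  - by apply: est; have := H1 _ _ y1 z1; rewrite !pt0 !pt1.
  - by rewrite phy phz; apply: est; have := H2 _ _ y2 z2; rewrite !pt0 !pt1.
exists r' => // y z y' z' pp pp'.
have /= := main y z pp; have /= := main y' z' pp'.
set t := slope phi y z; set w := slope phi y' z'.
set t' := slope phi (h y) (h z); set w' := slope phi (h y') (h z').
move=> [w1 w2 w3 [f1 [f2 [fE f1e f2e]]]] [t1 t2 t3 [e1 [e2 [eE e1e e2e]]]].
have key : (B'x - Bx * t') * (t - w) =
    (Ax + Bx * w) * (t' - w') + (e1 * t' - f1 * w' - e2 + f2).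
  have -> : e2 = (Ax + Bx * t + e1) * t' - A'x - B'x * t by rewrite eE; ring.
  have -> : f2 = (Ax + Bx * w + f1) * w' - A'x - B'x * w by rewrite fE; ring.
  by ring.
rewrite -(ler_pM2l nu0) mulrDr mulrA [nu * (kap / nu)]mulrC divfK ?gt_eqF//.
apply: (@le_trans _ _ `|(B'x - Bx * t') * (t - w)|).
  by rewrite normrM ler_wpM2r.
rewrite key; apply: le_trans (ler_normD _ _) _; apply: lerD.
  by rewrite normrM ler_wpM2r.
have k1 : `|e1 * t'| <= eps3 * (1 + B) * B by rewrite normrM; exact: ler_pM.
have k2 : `|f1 * w'| <= eps3 * (1 + B) * B by rewrite normrM; exact: ler_pM.
have -> : nu * eps = eps3 * (1 + B) * B + eps3 * (1 + B) * B + eps3 * (1 + B) + eps3 * (1 + B).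
  by rewrite /eps3; field; rewrite gt_eqF.
apply: le_trans (ler_normD _ _) _; apply: lerD => //.
apply: le_trans (ler_normB _ _) _; apply: lerD => //.
by apply: le_trans (ler_normB _ _) _; exact: lerD.
Qed.

Lemma stable_curve_tangent (F : R -> R) : Ck_extension 1 [set` I] phi c F ->
  'D_1 F c = s.
Proof.
move=> EF; have dF := nbhs_singleton (extension_derivative EF) cI.
apply: (derivative_within_unique (itv_clusters_at I_nondegenerate cI) dF).
move=> e /phi_tangent /nearP[r r0 H]; exists r => // y yI yr; exact: H.
Qed.

(** Each step gains one order: the coefficients of the slope equation are first partial derivatives
    of [g0] and [g1] along the curve, so they have class C^(k+1) once the curve has, and a slope
    function of that class makes the curve C^(k+2). *)
Lemma stable_curve_Ck k : Ck_at k.+1 P g0 -> Ck_at k.+1 P g1 ->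
  extends_Ck k.+1 [set` I] phi c.
Proof.
elim: k => [_ _|k IH CK0 CK1]; first exact: stable_curve_C1.
have [F EF] := IH (Ck_at_le (leqnSn _) CK0) (Ck_at_le (leqnSn _) CK1).
have [CF Fphi] := (Ck_extensionP _ _ _ _ _).1 EF.
have CF1 : Ck_at 1 c F by exact: Ck_at_le CF.
have EF1 : Ck_extension 1 [set` I] phi c F by apply/Ck_extensionP.
have Fc : F c = phi c by exact: (nbhs_singleton Fphi).
have wc := stable_curve_tangent EF1.
apply: (extends_Ck_derivative cI EF1).
pose w := 'D_1 F; pose hF x := g0 (pt x (F x)).
have hFc : hF c = c by rewrite /hF Fc.
have Cgr j : Ck_at j c F -> Ck_at j c (fun x => pt x (F x)).
  exact: Ck_at_pt (@Ck_at_id _ _ j c).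
have Ccomp j (g : plane R -> R) : (j <= k.+1)%N -> Ck_at j P g ->
    Ck_at j c (fun x => g (pt x (F x))).
  move=> jk Cg; apply: (Ck_at_comp_plane (Cgr j (Ck_at_le jk CF))).
  by rewrite Fc.
have ChF : Ck_at k.+1 c hF by apply: Ccomp => //; exact: Ck_at_le CK0.
have ChF1 : Ck_at 1 c hF by exact: Ck_at_le ChF.
pose A x := 'D_(pt 1 0) g0 (pt x (F x)); pose B x := 'D_(pt 0 1) g0 (pt x (F x)).
pose A' x := 'D_(pt 1 0) g1 (pt x (F x)); pose B' x := 'D_(pt 0 1) g1 (pt x (F x)).
have [CA CB] : Ck_at k.+1 c A /\ Ck_at k.+1 c B.
  by split; [apply: (Ccomp _ ('D_(pt 1 0) g0))|apply: (Ccomp _ ('D_(pt 0 1) g0))] => //;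
    exact: Ck_at_derive CK0.
have [CA' CB'] : Ck_at k.+1 c A' /\ Ck_at k.+1 c B'.
  by split; [apply: (Ccomp _ ('D_(pt 1 0) g1))|apply: (Ccomp _ ('D_(pt 0 1) g1))] => //;
    exact: Ck_at_derive CK1.
have [Ac Bc A'c B'c] : [/\ A c = a, B c = b, A' c = a' & B' c = b'].
  by rewrite /A /B /A' /B' Fc.
have mu0 : 0 < mu by exact: le_lt_trans lam_mu.
have dgraph (g : plane R -> R) x : Ck_at 1 x F -> Ck_at 1 (pt x (F x)) g ->
    is_derive x (1 : R) (fun y => g (pt y (F y)))
      ('D_(pt 1 0) g (pt x (F x)) + w x * 'D_(pt 0 1) g (pt x (F x))).
  move=> CFx Cgx; apply: is_derive_graph; last exact: Ck_at_differentiable Cgx.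
  by apply: diff_derivable; exact: Ck_at_differentiable CFx.
have dhFc : 'D_1 hF c = lam.
  have Cg0c : Ck_at 1 (pt c (F c)) g0 by rewrite Fc; exact Cg0.
  by have [_ ->] := dgraph g0 c CF1 Cg0c; rewrite -/(A c) -/(B c) Ac Bc /w wc mulrC.
(* [M] recovers the slope at [x] from the slope at the image of [x], by inverting the action of the
   Jacobian at [(x, F x)] on slopes. Using [F] in place of [phi] makes it smooth across the ends of
   [I]. *)
pose M (q : plane R) : R :=
  (q 0 1 * A (q 0 0) - A' (q 0 0)) / (B' (q 0 0) - q 0 1 * B (q 0 0)).
have Cfst (f : R -> R) : Ck_at k.+1 c f -> Ck_at k.+1 (pt c s) (fun q => f (q 0 0)).
  move=> Cf; have C0 : Ck_at k.+1 (pt c s) (fun q : plane R => q 0 0).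
    exact: (Ck_at_coord 0 (@Ck_at_id _ _ k.+1 (pt c s))).
  by apply: (Ck_at_comp (g := f) C0); rewrite pt0.
have Csnd : Ck_at k.+1 (pt c s) (fun q : plane R => q 0 1).
  exact: (Ck_at_coord 1 (@Ck_at_id _ _ k.+1 (pt c s))).
have den0 : b' - s * b = mu by rewrite -eig_mu; ring.
have CM : Ck_at k.+1 (pt c s) M.
  apply: Ck_atM; first by apply: Ck_atB (Cfst _ CA'); exact: Ck_atM Csnd (Cfst _ CA).
  apply: Ck_atV; first by rewrite pt0 pt1 B'c Bc den0 gt_eqF.
  by apply: Ck_atB (Cfst _ CB') _; exact: Ck_atM Csnd (Cfst _ CB).
apply: (@extends_Ck_functional _ I c I_nondegenerate cI hF hFc _ ChF1 _ _ k.+1 ChF M w).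
- near=> x => xI.
  have Fx : F x = phi x by move: xI; near: x.
  have [hxI _] : h x \in I /\ phi (h x) = g1 (pt x (phi x)) by move: xI; near: x.
  by rewrite /hF Fx.
- by rewrite dhFc.
- by rewrite dhFc.
- by rewrite /w wc.
- rewrite /w wc derive_vertical !pt0 !pt1.
  have -> : (fun t : R => M (pt c t)) = (fun t : R => (t * a - a') * (b' - t * b)^-1).
    by apply/funext => t; rewrite /M pt0 pt1 Ac Bc A'c B'c.
  have dn0 : b' - s * b != 0 by rewrite den0 gt_eqF.
  rewrite (_ : 'D_(1 : R) _ s = lam / mu); last first.
    rewrite (derive_mobius a a' dn0) den0.
    have -> : a' = lam * s - b' * s by rewrite -eig_lam1; ring.
    have -> : a = lam - b * s by rewrite -eig_lam0; ring.
    have -> : b' = mu + b * s by rewrite -eig_mu; ring.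
    by field; rewrite gt_eqF.
  by rewrite normrM normfV (gtr0_norm mu0) ltr_pdivrMr// mul1r.
- exists w; apply/Ck_extensionP; split; last by near=> x.
  exact: Ck_at_derive CF1.
have chF := Ck_at_continuous ChF1; rewrite /prop_for /continuous_at hFc in chF.
have FN : \forall x \near c, x \in I -> F (hF x) = g1 (pt x (F x)).
  have FhF : \forall x \near c, hF x \in I -> F (hF x) = phi (hF x) by exact: chF Fphi.
  apply: filterS3 Fphi FhF phi_invariant => x Fx FhFx inv xI.
  move: (FhFx); rewrite /hF (Fx xI) => {}FhFx.
  by have [hxI <-] := inv xI; exact: FhFx.
have nden : \forall x \near c, B' x - w (hF x) * B x != 0.
  have Cden : Ck_at 0 c (fun x => B' x - w (hF x) * B x).
    apply: Ck_atB (Ck_at_le (leq0n _) CB') _; apply: Ck_atM (Ck_at_le (leq0n _) CB).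
    apply: (Ck_at_comp (g := w) (Ck_at_le (leq0n _) ChF)); rewrite hFc.
    exact: Ck_at_derive CF1.
  apply: cvgr_neq0 (Ck_at_continuous Cden) _.
  by rewrite hFc B'c Bc /w wc den0 gt_eqF.
have CP (g : plane R -> R) : Ck_at 1 P g -> \forall x \near c, Ck_at 1 (pt x (F x)) g.
  move=> Cg; have cg := Ck_at_continuous (Cgr 1 CF1).
  rewrite /prop_for /continuous_at Fc in cg.
  exact: (cg _ (Ck_at_sub Cg)).
have CFh : \forall x \near c, Ck_at 1 (hF x) F by exact: (chF _ (Ck_at_sub CF1)).
apply: filterS3 (nbhs_interior FN) nden (filterI (filterI (Ck_at_sub CF1) CFh)
  (filterI (Ck_at_sub ChF1) (filterI (CP _ Cg0) (CP _ Cg1)))).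
move=> x nFN nz [[CFx CFhx] [ChFx [Cg0x Cg1x]]] xI.
have [r r0 Hr] : exists2 r : R, 0 < r &
    forall y, `|y - x| < r -> y \in I -> F (hF y) = g1 (pt y (F y)).
  exact/nearP.
have der (u : R -> R) : Ck_at 1 x u -> derivable u x 1.
  by move=> Cu; apply: diff_derivable; exact: Ck_at_differentiable Cu.
have dFhx : derivable F (hF x) 1.
  by apply: diff_derivable; exact: Ck_at_differentiable CFhx.
have dFh := is_derive_line_comp (der _ ChFx) dFhx.
(* [F \o hF] and the second component of the map agree on [I]; equating their derivatives within [I]
   gives the slope equation. *)
have E : w (hF x) * (A x + w x * B x) = A' x + w x * B' x.
  have [_ dh] := dgraph g0 x CFx Cg0x.
  apply: (@derivative_within_unique _ [set` I] (F \o hF) x).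
  - exact: itv_clusters_at.
  - by apply: is_derive_within; move: dFh; rewrite dh.
  apply: (@derivative_within_near _ [set` I] _ (fun y => g1 (pt y (F y))) _ _ _ r) => //.
  - by apply/esym/Hr => //; rewrite subrr normr0.
  - by move=> y yI yr; split=> //; exact/esym/Hr.
  exact: is_derive_within (dgraph g1 x CFx Cg1x).
rewrite /M pt0 pt1; apply: (mulIf nz); rewrite divfK//.
have -> : A' x = w (hF x) * (A x + w x * B x) - w x * B' x by rewrite E; ring.
by ring.
Unshelve. all: by end_near. Qed.

End StableCurve.

(** * Implicit curves *)

(** No solution has to be constructed, since [u] is given and continuous. The equation first yields
    a Lipschitz bound with constant [C], where [m] at most |b| / 2 absorbs the vertical increment;
    the second bound on [m] then brings the error down to [e]. *)
Lemma implicit_derivative_within (R : realType) (D : set R) (K : plane R -> R)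
    (u : R -> R) (x : R) :
  Ck_at 1 (pt x (u x)) K -> 'D_(pt 0 1) K (pt x (u x)) != 0 ->
  (forall eps, 0 < eps -> exists2 r : R, 0 < r &
    forall y, D y -> `|y - x| < r -> `|u y - u x| < eps) ->
  (exists2 r : R, 0 < r & forall y, D y -> `|y - x| < r ->
    K (pt y (u y)) = K (pt x (u x))) ->
  derivative_within D u x
    (- ('D_(pt 1 0) K (pt x (u x)) / 'D_(pt 0 1) K (pt x (u x)))).
Proof.
move=> [A [oA AP] CK]; set a := 'D_(pt 1 0) K _; set b := 'D_(pt 0 1) K _.
move=> bn0 uc [r0 r00 K0] e e0.
have b0 : 0 < `|b| by rewrite normr_gt0.
pose C := 2 * (`|a| + `|b|) / `|b|.
have C0 : 0 <= C.
  by apply: divr_ge0 (normr_ge0 b); apply: mulr_ge0 (ler0n _ _) (addr_ge0 _ _).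
pose m := Num.min (`|b| / 2) (e * `|b| / (1 + C)).
have m0 : 0 < m by rewrite lt_min !divr_gt0 ?mulr_gt0//; lra.
have [d d0 H] := strict_approx_plane oA CK AP m0.
have [r1 r10 H1] := uc d d0.
exists (Num.min (Num.min r0 d) r1); first by rewrite !lt_min r00 d0.
move=> y Dy; rewrite !lt_min => /andP[/andP[yr0 yd] /(H1 y Dy) uyd].
have := H (pt x (u x)) (pt y (u y)); rewrite subrr normr0 => /(_ d0).
rewrite ptB => /(_ (plane_norm_lt _ _)); rewrite !pt0 !pt1 => /(_ yd uyd).
rewrite K0// subrr sub0r normrN -/a -/b.
set X := y - x; set Y := u y - u x => k1.
have k2 : `|X * a + Y * b| <= m * (`|X| + `|Y|).
  by apply: le_trans k1 _; rewrite ler_pM2l//; have := plane_norm_le (pt X Y); rewrite pt0 pt1.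
have m1 : m <= `|b| / 2 by rewrite ge_min lexx.
have m2 : m <= e * `|b| / (1 + C) by rewrite ge_min lexx orbT.
have Y1 : `|Y| <= C * `|X|.
  have k3 := lerB_dist (Y * b) (- (X * a)).
  rewrite opprK normrN [Y * b + _]addrC !normrM in k3.
  have k4 : m * (`|X| + `|Y|) <= `|b| / 2 * (`|X| + `|Y|) by rewrite ler_wpM2r ?addr_ge0.
  rewrite -(ler_pM2l b0).
  have -> : `|b| * (C * `|X|) = 2 * (`|a| + `|b|) * `|X|.
    by rewrite /C mulrA mulrCA divff ?mulr1// gt_eqF.
  have : 0 <= `|b| * `|X| by exact: mulr_ge0.
  by clear -k2 k3 k4; lra.
have -> : Y - X * - (a / b) = (X * a + Y * b) / b by field.
rewrite normrM normfV ler_pdivrMr//; apply: le_trans k2 _.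
apply: (@le_trans _ _ (m * ((1 + C) * `|X|))).
  by rewrite ler_pM2l// mulrDl mul1r lerD2l.
rewrite mulrA [leRHS]mulrAC ler_wpM2r//.
by move: m2; rewrite ler_pdivlMr//; lra.
Qed.

(** The formula for the derivative of [u] as minus the quotient of the partial derivatives of [K]
    along the graph bootstraps: for [j] at most [k], if [u] has class C^j then so has the quotient,
    and [u] has class C^(j+1). *)
Lemma implicit_graph_Ck (R : realType) (I : interval R) (c : R) (u : R -> R)
    (K : plane R -> R) k :
  (exists a b, [/\ a \in I, b \in I & a < b]) -> c \in I ->
  (forall x, x \in I -> forall eps, 0 < eps -> exists2 r : R, 0 < r &
    forall y, y \in I -> `|y - x| < r -> `|u y - u x| < eps) ->
  Ck_at k.+1 (pt c (u c)) K -> 'D_(pt 0 1) K (pt c (u c)) != 0 ->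
  (\forall x \near c, x \in I -> K (pt x (u x)) = 0) ->
  extends_Ck k.+1 [set` I] u c.
Proof.
move=> Ind cI uc CK Kn0 K0; set P := pt c (u c) in CK Kn0.
have CK1 : Ck_at 1 P K by exact: Ck_at_le CK.
have [d d0 Hd] : exists2 d : R, 0 < d & forall q, `|q - P| < d ->
    Ck_at 1 q K /\ 'D_(pt 0 1) K q != 0.
  apply/nearP; apply: filterI (Ck_at_sub CK1) _.
  exact: cvgr_neq0 (Ck_at_continuous (Ck_at_derive (pt 0 1) CK)) Kn0.
have [r r0 Hr] := uc c cI d d0.
have [r1 r10 Hr1] := (nearP _ _).1 K0.
have du : \forall x \near c, x \in I -> derivative_within [set` I] u x
    (- ('D_(pt 1 0) K (pt x (u x)) / 'D_(pt 0 1) K (pt x (u x)))).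
  apply/nearP; exists (Num.min (Num.min d r) r1); first by rewrite !lt_min d0 r0.
  move=> x; rewrite !lt_min => /andP[/andP[xd xr] xr1] xI.
  have [CKx nz] : Ck_at 1 (pt x (u x)) K /\ 'D_(pt 0 1) K (pt x (u x)) != 0.
    by apply: Hd; rewrite /P ptB; apply: plane_norm_lt; rewrite ?pt0 ?pt1//; exact: Hr.
  apply: implicit_derivative_within => //; first exact: uc.
  exists (r1 - `|x - c|); first by rewrite subr_gt0.
  move=> y yI yx; rewrite !Hr1//.
  by rewrite -(subrK x y) -addrA; apply: le_lt_trans (ler_normD _ _) _; lra.
suff H j : (j <= k.+1)%N -> extends_Ck j [set` I] u c by exact: H.
elim: j => [_|j IH jk].
  by apply: extends_C0 => //; near=> x => xI; exact: uc.
have [F /Ck_extensionP[CF Fu]] := IH (ltnW jk).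
have Fc : F c = u c by exact: (nbhs_singleton Fu).
have CD v : Ck_at j c (fun x => 'D_v K (pt x (F x))).
  apply: (Ck_at_comp_plane (g := 'D_v K) (Ck_at_pt (@Ck_at_id _ _ j c) CF)).
  by rewrite Fc; apply: Ck_at_derive; exact: Ck_at_le CK.
have CV : Ck_at j c
    (fun x => - ('D_(pt 1 0) K (pt x (F x)) / 'D_(pt 0 1) K (pt x (F x)))).
  apply: Ck_atN; apply: Ck_atM (CD _) _; apply: Ck_atV (CD _).
  by rewrite Fc.
apply: (extends_Ck_primitive cI CV).
by apply: filterS2 Fu du => x Fx dx xI; rewrite Fx//; exact: dx.
Unshelve. all: by end_near. Qed.

(** * Eigenvalues of a planar Jacobian and the slope of the stable direction *)

Section PlanarEigenvalues.
Context {R : realType} (J : 'M[R]_2) (lam mu : R).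
Context (lam_eig : eigenvalue J lam).
Context (mu_eig : eigenvalue J mu).
Context (lam_mu : lam != mu).
Implicit Types v w : plane R.

Lemma mulmx_plane v j : (v *m J) 0 j = v 0 0 * J 0 j + v 0 1 * J 1 j.
Proof.
rewrite mxE big_ord_recl big_ord1; congr (_ + _ 0 _ * J _ _); exact/val_inj.
Qed.

(** Otherwise, by Cramer's rule with determinant [d], an eigenvector for [mu] would be a combination
    of [v] and [w], hence an eigenvector for [lam]. *)
Lemma eigenvectors_collinear v w : v *m J = lam *: v -> w *m J = lam *: w ->
  v 0 0 * w 0 1 = v 0 1 * w 0 0.
Proof.
move=> vJ wJ; apply/eqP; rewrite -subr_eq0; apply/negPn/negP => d0.
have [u uJ] := eigenvalueP mu_eig; apply/negP; rewrite negbK.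
set d := _ - _ in d0.
have dE : d *: u = (u 0 0 * w 0 1 - u 0 1 * w 0 0) *: v + (v 0 0 * u 0 1 - v 0 1 * u 0 0) *: w.
  by apply: plane_eqP; rewrite !mxE /d; ring.
have : d *: u *m J = lam *: (d *: u).
  by rewrite dE mulmxDl -!scalemxAl vJ wJ scalerDr !scalerA ![lam * _]mulrC.
rewrite -scalemxAl uJ scalerA [d * mu]mulrC -scalerA => /eqP.
by rewrite -subr_eq0 -scalerBl !scaler_eq0 subr_eq0 [mu == _]eq_sym (negbTE lam_mu) (negbTE d0).
Qed.

(** Matrices act on row vectors from the right. The eigenspace of [lam] is a line; since it is not
    an axis, both coordinates of a spanning [v] are nonzero and [s] is their quotient. The
    functional [u 0 1 - u 0 0 * s] vanishes on this line, so [J] multiplies it by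
    [J 1 1 - J 1 0 * s]; at an eigenvector for [mu] it is nonzero, which identifies the factor. *)
Lemma planar_eigen_slope :
  (forall i : 'I_2, ~~ (eigenspace J lam == (delta_mx 0 i : 'rV[R]_2))%MS) ->
  exists s : R, [/\ s != 0,
    forall v, (v <= eigenspace J lam)%MS -> v 0 1 = v 0 0 * s,
    J 0 0 + J 1 0 * s = lam, J 0 1 + J 1 1 * s = lam * s & J 1 1 - J 1 0 * s = mu].
Proof.
move=> haxis; have [v vJ v0] := eigenvalueP lam_eig.
have eP w : (w <= eigenspace J lam)%MS -> w *m J = lam *: w by move=> /eigenspaceP.
have vE : (v <= eigenspace J lam)%MS by apply/eigenspaceP.
have col w : (w <= eigenspace J lam)%MS -> v 0 0 * w 0 1 = v 0 1 * w 0 0.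
  by move=> /eP; exact: eigenvectors_collinear.
have v00 : v 0 0 != 0.
  apply/negP => /eqP z; have z1 : v 0 1 != 0.
    by apply: contraNneq v0 => z1; apply/eqP/plane_eqP; rewrite mxE.
  have /negP := haxis 1; apply; apply/andP; split.
    apply/rV_subP => w /col; rewrite z mul0r => /esym/eqP.
    rewrite mulf_eq0 (negbTE z1) /= => /eqP w0.
    have -> : w = w 0 1 *: delta_mx 0 1 by apply: plane_eqP; rewrite !mxE ?w0 /=; ring.
    exact: scalemx_sub.
  have -> : delta_mx 0 1 = (v 0 1)^-1 *: v.
    by apply: plane_eqP; rewrite !mxE ?z ?mulr0//= mulVf.
  exact: scalemx_sub.
have v01 : v 0 1 != 0.
  apply/negP => /eqP z; have /negP := haxis 0; apply; apply/andP; split.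
    apply/rV_subP => w /col; rewrite z mul0r => /eqP.
    rewrite mulf_eq0 (negbTE v00) /= => /eqP w0.
    have -> : w = w 0 0 *: delta_mx 0 0 by apply: plane_eqP; rewrite !mxE ?w0 /=; ring.
    exact: scalemx_sub.
  have -> : delta_mx 0 0 = (v 0 0)^-1 *: v.
    by apply: plane_eqP; rewrite !mxE ?z ?mulr0//= mulVf.
  exact: scalemx_sub.
have e0 : v 0 0 * J 0 0 + v 0 1 * J 1 0 = lam * v 0 0 by rewrite -mulmx_plane vJ mxE.
have e1 : v 0 0 * J 0 1 + v 0 1 * J 1 1 = lam * v 0 1 by rewrite -mulmx_plane vJ mxE.
pose s := v 0 1 / v 0 0.
have vs : v 0 1 = v 0 0 * s by rewrite /s mulrC divfK.
have l0 : J 0 0 + J 1 0 * s = lam.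
  by apply: (mulfI v00); rewrite [RHS]mulrC -e0 vs; ring.
have l1 : J 0 1 + J 1 1 * s = lam * s.
  by apply: (mulfI v00); rewrite [RHS]mulrCA -vs -e1 vs; ring.
exists s; split=> //.
- by rewrite /s mulf_neq0 ?invr_eq0.
- by move=> w /col; rewrite vs => h; apply: (mulfI v00); rewrite h; ring.
have [u uJ u0] := eigenvalueP mu_eig.
have m0 : u 0 0 * J 0 0 + u 0 1 * J 1 0 = mu * u 0 0 by rewrite -mulmx_plane uJ mxE.
have m1 : u 0 0 * J 0 1 + u 0 1 * J 1 1 = mu * u 0 1 by rewrite -mulmx_plane uJ mxE.
have z0 : u 0 1 - u 0 0 * s != 0.
  apply/negP => /eqP z; have us : u 0 1 = u 0 0 * s by lra.
  have : u 0 0 * (lam - mu) = 0.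
    by rewrite mulrBr -l0 [u 0 0 * mu]mulrC -m0 us; ring.
  move=> /eqP; rewrite mulf_eq0 subr_eq0 (negbTE lam_mu) orbF => /eqP u00.
  by move: u0; apply/negP; rewrite negbK; apply/eqP/plane_eqP; rewrite ?us u00 mxE ?mul0r.
apply: (mulIf z0).
have -> : mu * (u 0 1 - u 0 0 * s) = mu * u 0 1 - mu * u 0 0 * s by ring.
rewrite -m0 -m1.
have -> : J 0 1 = lam * s - J 1 1 * s by rewrite -l1; ring.
have -> : J 0 0 = lam - J 1 0 * s by rewrite -l0; ring.
by ring.
Qed.

End PlanarEigenvalues.

Lemma matrix2_eq (R : realType) (A B : 'M[R]_2) :
  (forall j, A 0 j = B 0 j /\ A 1 j = B 1 j) -> A = B.
Proof.
move=> AB; apply/matrixP => i j; have [AB0 AB1] := AB j.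
case: (unliftP 0 i) => [k|] ->//.
by rewrite ord1 (_ : lift _ _ = 1)//; exact/val_inj.
Qed.

Lemma planar_eigen_unit (R : realType) (J : 'M[R]_2) (lam mu s : R) :
  J 0 0 + J 1 0 * s = lam -> J 0 1 + J 1 1 * s = lam * s -> J 1 1 - J 1 0 * s = mu ->
  lam != 0 -> mu != 0 -> J \in unitmx.
Proof.
move=> e0 e1 em lam0 mu0.
(* The adjugate divided by the determinant, which is [lam * mu]. *)
pose B : 'M[R]_2 := \matrix_(i, j) ((lam * mu)^-1 *
  (if i == 0 then if j == 0 then J 1 1 else - J 0 1
   else if j == 0 then - J 1 0 else J 0 0)).
suff /mulmx1_unit[] : J *m B = 1%:M by [].
apply: matrix2_eq => j.
have JB i : (J *m B) i j = J i 0 * B 0 j + J i 1 * B 1 j.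
  rewrite mxE big_ord_recl big_ord1.
  by congr (_ + J _ _ * B _ _); exact/val_inj.
have J01 : J 0 1 = lam * s - J 1 1 * s by rewrite -e1; ring.
have J00 : J 0 0 = lam - J 1 0 * s by rewrite -e0; ring.
have J11 : J 1 1 = mu + J 1 0 * s by rewrite -em; ring.
rewrite !JB !mxE /=; case: (unliftP 0 j) => [k|] ->.
  rewrite ord1 (_ : lift _ _ = 1) /=; last exact/val_inj.
  by rewrite J01 J00 J11; split; field; rewrite lam0 mu0.
by rewrite J01 J00 J11 /=; split; field; rewrite lam0 mu0.
Qed.

(** * Competitive maps *)

Lemma derive_comp (R : realType) (V W X : normedModType R) (f : V -> W) (g : W -> X)
    (p v : V) : differentiable f p -> differentiable g (f p) ->
  'D_v (g \o f) p = 'D_('D_v f p) g (f p).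
Proof.
move=> df dg; have dgf : differentiable (g \o f) p by exact: differentiable_comp.
by rewrite (deriveE _ dgf) (deriveE _ dg) (deriveE _ df) diff_comp.
Qed.

Lemma derivative_within_le0 (R : realType) (D : set R) (u : R -> R) (x d : R) :
  clusters_at D x -> derivative_within D u x d ->
  (forall y, D y -> (u y - u x) * (y - x) <= 0) -> d <= 0.
Proof.
move=> ax du mu.
have d0 : derivative_within D (fun=> 0) x 0.
  by move=> e e0; exists 1 => // y _ _; rewrite subrr mulr0 subrr normr0 mulr_ge0// ltW.
rewrite -oppr_ge0 -sub0r; apply: (derivative_within_ge0 ax (derivative_withinB d0 du)).
move=> y /mu; have -> : (0 - u y - (0 - u x)) * (y - x) = - ((u y - u x) * (y - x)) by ring.
by rewrite oppr_ge0.
Qed.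

Section CompetitiveExtensions.
Context {R : realType} (I1 I2 : interval R).
Context (I1_nondegenerate : exists a b, [/\ a \in I1, b \in I1 & a < b]).
Context (I2_nondegenerate : exists a b, [/\ a \in I2, b \in I2 & a < b]).
Let D := rectangle I1 I2.
Implicit Types (q e w : plane R) (f g : plane R -> R) (T G : plane R -> plane R).

Lemma rectangle_slice_clusters_at q e : D q -> e = pt 1 0 \/ e = pt 0 1 ->
  clusters_at [set t | D (q + t *: e)] 0.
Proof.
move=> [q0 q1] ee r r0; case: ee => ->.
  have [y [yI yq yr]] := itv_clusters_at I1_nondegenerate q0 r0.
  exists (y - q 0 0); rewrite subr0 subr_eq0; split=> //.
  by rewrite /= /D /rectangle /= !mxE /= !mulr1 mulr0 addr0 addrC subrK.
have [y [yI yq yr]] := itv_clusters_at I2_nondegenerate q1 r0.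
exists (y - q 0 1); rewrite subr0 subr_eq0; split=> //.
by rewrite /= /D /rectangle /= !mxE /= !mulr1 mulr0 addr0 addrC subrK.
Qed.

Lemma derivative_within_slice f g q e : D q ->
  (\forall z \near q, D z -> g z = f z) -> differentiable g q ->
  derivative_within [set t | D (q + t *: e)] (fun t => f (q + t *: e)) 0 ('D_e g q).
Proof.
move=> Dq /nearP[r r0 H] dg.
have e0 : 0 < `|e| + 1 by have := normr_ge0 e; lra.
apply: (@derivative_within_near _ setT _ (fun t => g (q + t *: e)) _ _ _ (r / (`|e| + 1))).
- by rewrite divr_gt0.
- by rewrite scale0r addr0 H// subrr normr0.
- move=> t Dt; rewrite subr0 ltr_pdivlMr// => tr; split=> //; apply: H => //.
  rewrite addrC addKr normrZ; apply: le_lt_trans tr.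
  by rewrite ler_wpM2l// lerDl.
apply: is_derive_within.
have := @is_derive_segment _ _ g q e 0; rewrite scale0r addr0; apply.
exact: diff_derivable.
Qed.

(** Even at a corner of the rectangle the horizontal and vertical slices through [q] accumulate at
    [q], so [T] alone determines these derivatives. This transfers Jacobian data from one extension
    to another. *)
Lemma extension_partials_unique k T G G' q j e : D q -> e = pt 1 0 \/ e = pt 0 1 ->
  Ck_extension k.+1 D T q G -> Ck_extension k.+1 D T q G' ->
  'D_e (fun z => G z 0 j) q = 'D_e (fun z => G' z 0 j) q.
Proof.
move=> Dq ee /Ck_extensionP[CG GT] /Ck_extensionP[CG' G'T].
apply: (derivative_within_unique (rectangle_slice_clusters_at Dq ee)
  (u := fun t => T (q + t *: e) 0 j)); apply: (derivative_within_slice (f := fun z => T z 0 j)) => //.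
- by apply: filterS GT => z zE Dz; rewrite zE.
- exact: Ck_at_differentiable (Ck_at_coord j CG).
- by apply: filterS G'T => z zE Dz; rewrite zE.
- exact: Ck_at_differentiable (Ck_at_coord j CG').
Qed.

(** Monotonicity along slices of the rectangle passes to derivatives within them, so the signs hold
    at boundary points too. *)
Lemma competitive_partials k T G q : competitive_on D T -> D q ->
  Ck_extension k.+1 D T q G ->
  [/\ 0 <= 'D_(pt 1 0) (fun z => G z 0 0) q, 'D_(pt 1 0) (fun z => G z 0 1) q <= 0,
      'D_(pt 0 1) (fun z => G z 0 0) q <= 0 & 0 <= 'D_(pt 0 1) (fun z => G z 0 1) q].
Proof.
move=> [Tx Ty] Dq /Ck_extensionP[CG GT].
have slice e j : derivative_within [set t | D (q + t *: e)]
    (fun t => T (q + t *: e) 0 j) 0 ('D_e (fun z => G z 0 j) q).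
  apply: (derivative_within_slice (f := fun z => T z 0 j)) => //.
    by apply: filterS GT => z zE Dz; rewrite zE.
  exact: Ck_at_differentiable (Ck_at_coord j CG).
have a0 := rectangle_slice_clusters_at Dq (or_introl erefl).
have a1 := rectangle_slice_clusters_at Dq (or_intror erefl).
have qx (t : R) : q + t *: pt 1 0 = pt (q 0 0 + t) (q 0 1).
  by apply: plane_eqP; rewrite !mxE /=; ring.
have qy (t : R) : q + t *: pt 0 1 = pt (q 0 0) (q 0 1 + t).
  by apply: plane_eqP; rewrite !mxE /=; ring.
have Dq' : D (pt (q 0 0) (q 0 1)) by rewrite pt_eta.
have monx t : D (q + t *: pt 1 0) ->
    0 <= (T (q + t *: pt 1 0) 0 0 - T q 0 0) * t /\
    (T (q + t *: pt 1 0) 0 1 - T q 0 1) * t <= 0.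
  have -> : T q = T (pt (q 0 0) (q 0 1)) by rewrite pt_eta.
  rewrite qx => Dt.
  have [t0|t0] := lerP 0 t.
    have [|h0 h1] := Tx (q 0 0) (q 0 0 + t) (q 0 1) Dq' Dt; first by rewrite lerDl.
    by split; [apply: mulr_ge0|apply: mulr_le0_ge0]; rewrite ?subr_ge0 ?subr_le0.
  have [|h0 h1] := Tx (q 0 0 + t) (q 0 0) (q 0 1) Dt Dq'; first by rewrite gerDl ltW.
  by split; [apply: mulr_le0|apply: mulr_ge0_le0]; rewrite ?subr_ge0 ?subr_le0// ltW.
have mony t : D (q + t *: pt 0 1) ->
    (T (q + t *: pt 0 1) 0 0 - T q 0 0) * t <= 0 /\
    0 <= (T (q + t *: pt 0 1) 0 1 - T q 0 1) * t.
  have -> : T q = T (pt (q 0 0) (q 0 1)) by rewrite pt_eta.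
  rewrite qy => Dt.
  have [t0|t0] := lerP 0 t.
    have [|h0 h1] := Ty (q 0 0) (q 0 1) (q 0 1 + t) Dq' Dt; first by rewrite lerDl.
    by split; [apply: mulr_le0_ge0|apply: mulr_ge0]; rewrite ?subr_ge0 ?subr_le0.
  have [|h0 h1] := Ty (q 0 0) (q 0 1 + t) (q 0 1) Dt Dq'; first by rewrite gerDl ltW.
  by split; [apply: mulr_ge0_le0|apply: mulr_le0]; rewrite ?subr_ge0 ?subr_le0// ltW.
split.
- apply: (derivative_within_ge0 a0 (slice _ 0)) => t /monx[h _].
  by rewrite scale0r addr0 subr0.
- apply: (derivative_within_le0 a0 (slice _ 1)) => t /monx[_ h].
  by rewrite scale0r addr0 subr0.
- apply: (derivative_within_le0 a1 (slice _ 0)) => t /mony[h _].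
  by rewrite scale0r addr0 subr0.
- apply: (derivative_within_ge0 a1 (slice _ 1)) => t /mony[_ h].
  by rewrite scale0r addr0 subr0.
Qed.

Lemma derive_coordinate G q w j : differentiable G q ->
  'D_w (fun z => G z 0 j) q = 'D_w G q 0 j.
Proof. exact: (derive_linear_comp (L := coordinate j) w (@coordinate_continuous _ j)). Qed.

Lemma jacobian_entry G q j : differentiable G q ->
  'J G q 0 j = 'D_(pt 1 0) (fun z => G z 0 j) q /\
  'J G q 1 j = 'D_(pt 0 1) (fun z => G z 0 j) q.
Proof.
move=> dG; rewrite !derive_coordinate// !deriveEjacobian// !mulmx_plane !pt0 !pt1.
by split; ring.
Qed.

(** The closed second quadrant without the origin. The inequalities are weak because those on the
    partial derivatives of a competitive map are. *)
Definition NW_direction w : Prop := [/\ w 0 0 <= 0, 0 <= w 0 1 & w != 0].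

(** Extensions at successive points of the orbit are composed; on [D] the composite is the iterate
    because [T] maps [D] into itself. The signs of the partial derivatives preserve the closed
    second quadrant, and invertibility keeps the image vector nonzero. *)
Lemma iterate_extension k T (C : set (plane R)) : (forall q, D q -> D (T q)) ->
  C `<=` D -> (forall q, C q -> C (T q)) -> competitive_on D T ->
  (forall q, C q -> exists2 G, Ck_extension k.+1 D T q G & 'J G q \in unitmx) ->
  forall n q, C q -> exists2 H, Ck_extension k.+1 D (fun z => iter n T z) q H &
    forall w, NW_direction w -> NW_direction ('D_w H q).
Proof.
move=> TD CD TC compT hG; elim=> [|n IH] q Cq.
  exists id.
    by apply/Ck_extensionP; split; [exact: Ck_at_id|near=> z].
  by move=> w; rewrite derive_id.
have [H /Ck_extensionP[CH HT] nwH] := IH q Cq.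
have Cn : C (iter n T q) by elim: (n) => //= m; exact: TC.
have Hq : H q = iter n T q by apply: (nbhs_singleton HT); exact: CD.
have [G EG uG] := hG _ Cn; have [CG GT] := (Ck_extensionP _ _ _ _ _).1 EG.
have CGH : Ck_at k.+1 (H q) G by rewrite Hq.
have dH := Ck_at_differentiable CH; have dG := Ck_at_differentiable CG.
exists (G \o H).
  apply/Ck_extensionP; split; first exact: (Ck_at_comp_map CH).
  have cH := Ck_at_continuous CH; rewrite /prop_for /continuous_at Hq in cH.
  have GTH : \forall z \near q, D (H z) -> G (H z) = T (H z) by exact: cH GT.
  near=> z => Dz /=; have Hz : H z = iter n T z by move: Dz; near: z.
  have Dn : D (H z) by rewrite Hz; elim: (n) => //= m; exact: TD.
  by rewrite -Hz; move: Dn; near: z.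
move=> w /nwH; set w' := 'D_w H q => -[w0 w1 wn0].
have dGH : differentiable G (H q) by rewrite Hq.
have -> : 'D_w (G \o H) q = w' *m 'J G (iter n T q).
  by rewrite (derive_comp w dH dGH) Hq (deriveEjacobian _ dG).
have [s00 s01 s10 s11] := competitive_partials compT (CD _ Cn) EG.
have [j00 j10] := jacobian_entry 0 dG; have [j01 j11] := jacobian_entry 1 dG.
split.
- rewrite mulmx_plane j00 j10.
  by rewrite -oppr_ge0 opprD addr_ge0// oppr_ge0; [exact: mulr_le0_ge0|exact: mulr_ge0_le0].
- by rewrite mulmx_plane j01 j11 addr_ge0//; [exact: mulr_le0|exact: mulr_ge0].
- apply: contraNneq wn0 => z; apply/eqP.
  by rewrite -(mulmxK uG w') z mul0mx.
Unshelve. all: by end_near. Qed.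

End CompetitiveExtensions.

(** * Propagation along the curve *)

Section GraphOfCurve.
Context {R : realType} (I : interval R) (phi : R -> R).
Context (phi_within_continuous : {within [set` I], continuous phi}).

Lemma within_continuous_dist x : x \in I -> forall eps, 0 < eps ->
  exists2 r : R, 0 < r & forall y, y \in I -> `|y - x| < r -> `|phi y - phi x| < eps.
Proof.
move=> xI eps eps0; have /subspace_continuousP/(_ x xI) cx := phi_within_continuous.
have /nearP[r r0 H] : \forall y \near x, y \in I -> `|phi x - phi y| < eps.
  by have /cvgrPdist_lt/(_ _ eps0) := cx; rewrite near_withinE.
by exists r => // y yI /H; rewrite distrC; exact.
Qed.

Lemma graph_point_dist x : x \in I -> forall eps, 0 < eps ->
  \forall y \near x, y \in I -> `|pt y (phi y) - pt x (phi x)| < eps.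
Proof.
move=> xI eps eps0; have [r r0 H] := within_continuous_dist xI eps0.
apply/nearP; exists (Num.min eps r) => [|y]; first by rewrite lt_min eps0.
rewrite lt_min => /andP[ye yr] yI; rewrite ptB.
by apply: plane_norm_lt; rewrite ?pt0 ?pt1//; exact: H.
Qed.

Lemma graph_pt x : x \in I -> graph I phi (pt x (phi x)).
Proof. by move=> xI; split; rewrite ?pt0 ?pt1. Qed.

Lemma graph_ptE q : graph I phi q -> q = pt (q 0 0) (phi (q 0 0)).
Proof. by move=> [_ q1]; rewrite -q1 pt_eta. Qed.

(** Tangency measures the error against the full length of a chord, a derivative against [x - c]
    alone. The length is at most [S] times the horizontal part plus the error [W], and [kap] at most
    1/2 lets that [W] be absorbed on the left. *)
Lemma tangential_slope (E : 'M[R]_2) (s c : R) : c \in I ->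
  (forall v : plane R, (v <= E)%MS -> v 0 1 = v 0 0 * s) ->
  tangential (graph I phi) E (pt c (phi c)) -> forall eta, 0 < eta ->
  \forall x \near c, x \in I -> `|phi x - phi c - (x - c) * s| <= eta * `|x - c|.
Proof.
move=> cI Es tan eta eta0; have s0 := normr_ge0 s.
pose S := 1 + `|s|; have S0 : 0 < S by rewrite /S; lra.
pose kap := Num.min (1 / 2) (eta / (2 * S)).
have kap0 : 0 < kap by rewrite lt_min !divr_gt0// mulr_gt0.
have kap1 : kap <= 1 / 2 by rewrite ge_min lexx.
have kap2 : 2 * kap * S <= eta.
  have : kap <= eta / (2 * S) by rewrite ge_min lexx orbT.
  by rewrite ler_pdivlMr ?mulr_gt0//; lra.
have eps0 : 0 < kap / S by rewrite divr_gt0.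
have /nearP[d d0 H] := tan _ eps0.
apply: filterS (graph_point_dist cI d0) => x + xI => /(_ xI) xd.
have [v /Es vs] := H _ xd (graph_pt xI).
rewrite ptB; set X := x - c; set Y := phi x - phi c => k1.
have h0 := le_trans (normr_coord (pt X Y - v) 0) k1.
have h1 := le_trans (normr_coord (pt X Y - v) 1) k1.
rewrite !mxE /= in h0; rewrite !mxE /= vs in h1.
set r := v 0 0 in h0 h1; set n := `|pt X Y| in h0 h1.
have n1 : n <= `|X| + `|Y| by have := plane_norm_le (pt X Y); rewrite pt0 pt1.
set W := Y - X * s.
have W1 : `|W| <= kap * n.
  have -> : W = (Y - r * s) - (X - r) * s by rewrite /W; ring.
  apply: le_trans (ler_normB _ _) _; rewrite normrM.
  have k2 := ler_wpM2r s0 h0.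
  have -> : kap * n = kap / S * n * S by field; rewrite gt_eqF.
  by rewrite /S in h1 k2 *; lra.
have Y1 : `|Y| <= `|W| + `|X| * `|s|.
  have -> : Y = W + X * s by rewrite /W subrK.
  by rewrite -normrM; exact: ler_normD.
have k2 : kap * n <= kap * (S * `|X| + `|W|).
  by rewrite ler_pM2l//; apply: le_trans n1 _; rewrite /S; lra.
have k3 : kap * `|W| <= 1 / 2 * `|W| by rewrite ler_wpM2r.
have k4 : 2 * kap * S * `|X| <= eta * `|X| by rewrite ler_wpM2r.
by clear -W1 k2 k3 k4; lra.
Qed.

End GraphOfCurve.

Lemma strictly_ordered_interior (R : realType) (p q : plane R) :
  (p 0 0 < q 0 0 /\ p 0 1 < q 0 1) \/ (q 0 0 < p 0 0 /\ q 0 1 < p 0 1) ->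
  interior (Q1 p `|` Q3 p) q.
Proof.
move=> [[h0 h1]|[h0 h1]]; apply: (nearP q _).2.
  exists (Num.min (q 0 0 - p 0 0) (q 0 1 - p 0 1)); first by rewrite lt_min !subr_gt0 h0.
  move=> z; rewrite lt_min => /andP[z0 z1]; left; split.
    have := le_lt_trans (normr_coord (z - q) 0) z0; rewrite !mxE => /ltr_normlP[? ?]; lra.
  have := le_lt_trans (normr_coord (z - q) 1) z1; rewrite !mxE => /ltr_normlP[? ?]; lra.
exists (Num.min (p 0 0 - q 0 0) (p 0 1 - q 0 1)); first by rewrite lt_min !subr_gt0 h0.
move=> z; rewrite lt_min => /andP[z0 z1]; right; split.
  have := le_lt_trans (normr_coord (z - q) 0) z0; rewrite !mxE => /ltr_normlP[? ?]; lra.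
have := le_lt_trans (normr_coord (z - q) 1) z1; rewrite !mxE => /ltr_normlP[? ?]; lra.
Qed.

Lemma stable_germ_Ck (R : realType) (I1 I2 I : interval R)
    (T : plane R -> plane R) (phi f : R -> R) (c : R) m :
  let D := rectangle I1 I2 in
  (exists a b, [/\ a \in I1, b \in I1 & a < b]) ->
  (exists a b, [/\ a \in I2, b \in I2 & a < b]) ->
  (forall q, D q -> D (T q)) -> competitive_on D T ->
  (exists a b, [/\ a \in I, b \in I & a < b]) ->
  {within [set` I], continuous phi} ->
  graph I phi `<=` D -> (forall q, graph I phi q -> graph I phi (T q)) ->
  c \in I -> Ck_extension m.+1 [set` I] phi c f -> 0 < 'D_1 f c ->
  (forall q, graph I phi q -> exists2 G, Ck_extension m.+1 D T q G & 'J G q \in unitmx) ->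
  (forall q, graph I phi q -> (fun n => iter n T q) @ \oo --> pt c (phi c)) ->
  class_Ck m.+1 [set` I] phi [set` I].
Proof.
move=> D nd1 nd2 TD hcomp Ind phiC CD TC cI Ef fc_gt0 unitJ Cbasin.
have [Cf fphi] := (Ck_extensionP _ _ _ _ _).1 Ef.
have phi_dist := within_continuous_dist phiC.
set P0 := pt c (phi c) in Cbasin.
move=> x0 x0I; set p := pt x0 (phi x0).
have Cp : graph I phi p by exact: graph_pt.
have good : \forall x \near c,
    [/\ x \in I -> f x = phi x, Ck_at m.+1 x f & 0 < 'D_1 f x].
  have cf := Ck_at_continuous (Ck_at_derive (1 : R) Cf).
  near=> x; split; first by move=> xI; move: xI; near: x; exact: fphi.
    by near: x; exact: Ck_at_sub Cf.
  have : `|'D_1 f c - 'D_1 f x| < 'D_1 f c.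
    by near: x; exact: (continuous_dist_lt cf).
  by move=> /ltr_normlP[? ?]; lra.
have [d d0 Hd] := (nearP _ _).1 good.
have near_c z : `|z - P0| < d -> `|z 0 0 - c| < d.
  apply: le_lt_trans; have -> : z 0 0 - c = (z - P0) 0 0 by rewrite !mxE.
  exact: normr_coord.
have [n nd] : exists n, `|iter n T p - P0| < d.
  have cvp := Cbasin _ Cp.
  have /cvgrPdist_lt/(_ _ d0)[n _ /(_ n (leqnn n))] := cvp.
  by rewrite /= distrC; exists n.
have Citer z k' : graph I phi z -> graph I phi (iter k' T z).
  by move=> Cz; elim: k' => //= k' IH; exact: TC.
have [H EH nwH] := iterate_extension nd1 nd2 TD CD TC hcomp unitJ n Cp.
have [CH HT] := (Ck_extensionP _ _ _ _ _).1 EH.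
have dH := Ck_at_differentiable CH.
have Hp : H p = iter n T p by apply: (nbhs_singleton HT); exact: CD.
(* The zero set of [K] is the preimage, under the extended [n]-th iterate, of the graph of [f]. *)
pose K z := H z 0 1 - f (H z 0 0).
have [fH CfH df_gt0] := Hd _ (near_c _ nd).
rewrite -Hp in fH CfH df_gt0.
have CH0 := Ck_at_coord 0 CH; have CH1 := Ck_at_coord 1 CH.
have CfH0 : Ck_at m.+1 p (fun z => f (H z 0 0)) by exact: (Ck_at_comp (g := f) CH0).
apply: (implicit_graph_Ck (K := K) Ind x0I phi_dist).
- exact: Ck_atB CH1 CfH0.
- have [w0 w1 wn0] : NW_direction ('D_(pt 0 1) H p).
    apply: nwH; split; rewrite ?pt0 ?pt1//.
    by apply/negP => /eqP/(congr1 (fun z : plane R => z 0 1)) /eqP; rewrite pt1 mxE oner_eq0.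
  have dfH := Ck_at_differentiable CfH.
  have -> : 'D_(pt 0 1) K p =
      'D_(pt 0 1) H p 0 1 - 'D_1 f (H p 0 0) * 'D_(pt 0 1) H p 0 0.
    rewrite /K deriveB; last 2 first.
    + by apply: diff_derivable; exact: Ck_at_differentiable CH1.
    + by apply: diff_derivable; exact: Ck_at_differentiable CfH0.
    rewrite derive_coordinate//; congr (_ - _).
    have dH0 := Ck_at_differentiable CH0.
    rewrite (derive_comp (f := fun z => H z 0 0) (g := f) (pt 0 1) dH0 dfH).
    rewrite (derive_frame _ (@line_frame R) dfH) derive0 scaler0 addr0.
    by rewrite derive_coordinate// mulrC.
  set w := 'D_(pt 0 1) H p in w0 w1 wn0 *; set D1 := 'D_1 f _ in df_gt0 *.
  (* Both [w 0 1] and [- (D1 * w 0 0)] are nonnegative; if their sum vanishes then so does [w]. *)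
  apply: contraNneq wn0 => z.
  have k1 : D1 * w 0 0 <= 0 by rewrite pmulr_rle0.
  have k2 : w 0 1 = 0 by lra.
  have k3 : D1 * w 0 0 = 0 by lra.
  apply/eqP/plane_eqP; rewrite mxE //.
  by move/eqP: k3; rewrite mulf_eq0 gt_eqF//= => /eqP.
(* The index [n] was chosen for [x0] alone; by continuity the same iterate brings a whole piece of
   the curve close to the fixed point, where [f] is [phi] on [I]. *)
have HT0 : \forall x \near x0, x \in I -> H (pt x (phi x)) = iter n T (pt x (phi x)) /\
    `|H (pt x (phi x)) - P0| < d.
  have cH := Ck_at_continuous CH; rewrite /prop_for /continuous_at in cH.
  have nb : \forall y \near H p, `|y - P0| < d.
    apply/nearP; exists (d - `|H p - P0|); first by rewrite subr_gt0 Hp.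
    move=> z zd; rewrite -(subrK (H p) z) -addrA; apply: le_lt_trans (ler_normD _ _) _; lra.
  have nH : \forall z \near p, `|H z - P0| < d by exact: (cH _ nb).
  have [r r0 Hr] := (nearP _ _).1 (filterI HT nH).
  apply: filterS (graph_point_dist phiC x0I r0) => x + xI => /(_ xI)/Hr[HTx ?].
  by split=> //; apply: HTx; apply: CD; exact: graph_pt.
apply: filterS HT0 => x + xI => /(_ xI)[HTx Hx].
have [HI Hphi] := Citer _ n (graph_pt phi xI); rewrite -HTx in HI Hphi.
have [fE _ _] := Hd _ (near_c _ Hx).
by rewrite /K Hphi fE// subrr.
Unshelve. all: by end_near. Qed.

(** * Consequences of monotonicity and invariance of the curve, and the conclusion *)

Lemma increasing_slope_ge0 (R : realType) (I : interval R) (phi : R -> R) (c s : R) :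
  (exists a b, [/\ a \in I, b \in I & a < b]) -> c \in I ->
  {in I &, {homo phi : x y / x < y}} ->
  (forall eta, 0 < eta -> \forall x \near c, x \in I ->
    `|phi x - phi c - (x - c) * s| <= eta * `|x - c|) -> 0 <= s.
Proof.
move=> Ind cI phi_incr tangent.
apply: (derivative_within_ge0 (itv_clusters_at Ind cI) (u := phi)).
  by move=> e /tangent /nearP[r r0 H]; exists r => // y yI yr; exact: H.
move=> y yI; have [cy|yc|->] := ltgtP c y; last by rewrite !subrr mul0r.
  by rewrite mulr_ge0 ?subr_ge0 ?ltW//; exact: phi_incr.
by rewrite mulr_le0 ?subr_le0 ?ltW//; exact: phi_incr.
Qed.

Lemma extension_curve_invariant (R : realType) (I : interval R) (phi : R -> R)
    (D : set (plane R)) (T G : plane R -> plane R) (c : R) :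
  {within [set` I], continuous phi} -> c \in I -> graph I phi `<=` D ->
  (forall q, graph I phi q -> graph I phi (T q)) ->
  (\forall q \near pt c (phi c), D q -> G q = T q) ->
  \forall x \near c, x \in I -> G (pt x (phi x)) 0 0 \in I /\
    phi (G (pt x (phi x)) 0 0) = G (pt x (phi x)) 0 1.
Proof.
move=> phiC cI CD TC GT; have [d d0 Hd] := (nearP _ _).1 GT.
apply: filterS (graph_point_dist phiC cI d0) => x + xI => /(_ xI)/Hd.
move=> /(_ (CD _ (graph_pt phi xI))) ->.
by have [TI ->] := TC _ (graph_pt phi xI).
Qed.

Lemma increasing_graph_Delta (R : realType) (I : interval R) (phi : R -> R)
    (D : set (plane R)) (p q : plane R) :
  {in I &, {homo phi : x y / x < y}} -> graph I phi `<=` D ->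
  graph I phi p -> graph I phi q -> q 0 0 != p 0 0 -> Delta D p q.
Proof.
move=> phi_incr CD Cp Cq qp; split; first exact: CD.
apply: strictly_ordered_interior; have [[pI ->] [qI ->]] := (Cp, Cq).
have [lt_pq|lt_qp|eq_pq] := ltgtP (p 0 0) (q 0 0).
- by left; split=> //; exact: phi_incr.
- by right; split=> //; exact: phi_incr.
- by move: qp; rewrite eq_pq eqxx.
Qed.

Theorem theorem3 (R : realType) (I1 I2 : interval R)
  (T : 'rV[R]_2 -> 'rV[R]_2) (xbar : 'rV[R]_2)
  (F : 'rV[R]_2 -> 'rV[R]_2) (lam mu : R) (k : nat) (U : set 'rV[R]_2)
  (hmap : region_map (rectangle I1 I2) T)
  (hcomp : competitive_on (rectangle I1 I2) T)
  (hxbar : rectangle I1 I2 xbar) (hfix : T xbar = xbar)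
  (hDelta : Delta (rectangle I1 I2) xbar !=set0)
  (hstrong : strongly_competitive_on (Delta (rectangle I1 I2) xbar) T)
  (hF : Ck_extension 1 (rectangle I1 I2) T xbar F)
  (hlam : eigenvalue ('J F xbar) lam) (hmu : eigenvalue ('J F xbar) mu)
  (hlam_gt0 : 0 < `|lam|) (hlam_mu : `|lam| < mu) (hlam_lt1 : `|lam| < 1)
  (haxis : forall i : 'I_2,
     ~~ (eigenspace ('J F xbar) lam == (delta_mx 0 i : 'rV[R]_2))%MS)
  (hk : (1 <= k)%N) (hU : nbhs xbar U)
  (hCk : class_Ck k (rectangle I1 I2) T (U `|` Delta (rectangle I1 I2) xbar))
  (hinv : forall x, Delta (rectangle I1 I2) xbar x ->
     forall G, Ck_extension 1 (rectangle I1 I2) T x G -> 'J G x \in unitmx)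
  (I : interval R) (phi : R -> R)
  (hcurve : invariant_curve (rectangle I1 I2) T xbar
              (eigenspace ('J F xbar) lam) I phi) :
  class_Ck k [set` I] phi [set` I].
Proof.
have [Ind phiC phi_incr CD Cx TC Cbasin Ctan _] := hcurve.
case: k hk hCk => // m _ hCm.
set D := rectangle I1 I2 in hmap hcomp hxbar hF hCm hinv CD Cbasin *.
have [_ TD] := hmap.
(* Two points of the strictly increasing curve differ in both coordinates, so neither side of the
   rectangle is degenerate. *)
have [nd1 nd2] : (exists a b, [/\ a \in I1, b \in I1 & a < b]) /\
    (exists a b, [/\ a \in I2, b \in I2 & a < b]).
  have [a [b [aI bI ab]]] := Ind.
  have [a1 a2] := CD _ (graph_pt phi aI); have [b1 b2] := CD _ (graph_pt phi bI).
  rewrite !pt0 !pt1 in a1 a2 b1 b2.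
  by split; [exists a, b|exists (phi a), (phi b); split=> //; exact: phi_incr].
pose c := xbar 0 0; have cI : c \in I by case: Cx.
have xbarE : xbar = pt c (phi c) by exact: graph_ptE Cx.
have phi_dist := within_continuous_dist phiC.
have EF1 : Ck_extension 1 D T xbar F by [].
have [CF _] := (Ck_extensionP _ _ _ _ _).1 EF1.
have dF := Ck_at_differentiable CF.
have lam_mu : lam != mu.
  by apply: contraTneq hlam_mu => ->; rewrite -leNgt ler_norm.
have mu_neq0 : mu != 0 by exact: lt0r_neq0 (le_lt_trans (normr_ge0 lam) hlam_mu).
have lam_neq0 : lam != 0 by move: hlam_gt0; rewrite normr_gt0.
have [s [s_neq0 Es eig0 eig1 eigmu]] := planar_eigen_slope hlam hmu lam_mu haxis.
clear hlam hmu haxis.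
(* The eigenvalue data concern [F], which is C^1, while [G] carries the higher class; the equality
   of partial derivatives at [xbar] moves the data to [G]. *)
have [G EG] : exists G, Ck_extension m.+1 D T xbar G.
  by apply: hCm; left; exact: nbhs_singleton hU.
have [CG GT] := (Ck_extensionP _ _ _ _ _).1 EG.
have dG := Ck_at_differentiable CG.
have EG1 : Ck_extension 1 D T xbar G by exact: Ck_extension_le EG.
have partials j : 'D_(pt 1 0) (fun z => G z 0 j) xbar = 'J F xbar 0 j /\
    'D_(pt 0 1) (fun z => G z 0 j) xbar = 'J F xbar 1 j.
  have [Fj0 Fj1] := jacobian_entry j dF; split.
    apply: etrans (esym Fj0).
    by apply: (extension_partials_unique nd1 nd2 j hxbar _ EG1 EF1); left.
  apply: etrans (esym Fj1).
  by apply: (extension_partials_unique nd1 nd2 j hxbar _ EG1 EF1); right.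
have JGF : 'J G xbar = 'J F xbar.
  apply: matrix2_eq => j; have [Gj0 Gj1] := jacobian_entry j dG.
  have [pj0 pj1] := partials j.
  by split; [exact: etrans Gj0 pj0|exact: etrans Gj1 pj1].
have [eig0F [eig1F eigmuF]] := conj eig0 (conj eig1 eigmu).
pose g0 z := G z 0 0; pose g1 z := G z 0 1.
have [j00 j10] := partials 0; have [j01 j11] := partials 1.
rewrite -j00 -j10 in eig0; rewrite -j01 -j11 in eig1; rewrite -j10 -j11 in eigmu.
have Gxbar : G xbar = xbar by rewrite -[RHS]hfix; exact: (nbhs_singleton GT).
have tangent := tangential_slope phiC cI Es.
rewrite -xbarE in tangent; have {}tangent := tangent Ctan.
(* Monotonicity of the curve gives only [0 <= s]; strictness comes from the eigenspace not being an
   axis. *)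
have s_gt0 : 0 < s.
  by rewrite lt_def s_neq0; exact: increasing_slope_ge0 Ind cI phi_incr tangent.
rewrite xbarE in GT; have invariant := extension_curve_invariant phiC cI CD TC GT.
rewrite -xbarE in GT.
have [f Ef] : extends_Ck m.+1 [set` I] phi c.
  have C0 : Ck_at m.+1 (pt c (phi c)) g0 by rewrite -xbarE; exact: Ck_at_coord CG.
  have C1 : Ck_at m.+1 (pt c (phi c)) g1 by rewrite -xbarE; exact: Ck_at_coord CG.
  apply: (stable_curve_Ck (lam := lam) (mu := mu) (s := s) Ind cI _ _ _ hlam_gt0
    hlam_mu hlam_lt1 _ _ _ phi_dist invariant tangent C0 C1).
  - by rewrite -xbarE /g0 Gxbar.
  - exact: Ck_at_le C0.
  - exact: Ck_at_le C1.
  - by rewrite -xbarE.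
  - by rewrite -xbarE.
  - by rewrite -xbarE.
have [Cf fphi] := (Ck_extensionP _ _ _ _ _).1 Ef.
have Ef1 : Ck_extension 1 [set` I] phi c f by exact: Ck_extension_le Ef.
have fc : 'D_1 f c = s by exact: (stable_curve_tangent Ind cI tangent Ef1).
(* At [xbar] the determinant is [lam * mu]; every other point of the increasing curve lies in
   [Delta], where invertibility is a hypothesis on all C^1 extensions. *)
have unitJ q : graph I phi q -> exists2 Gq, Ck_extension m.+1 D T q Gq & 'J Gq q \in unitmx.
  move=> Cq; have [qx|qx] := eqVneq (q 0 0) c.
    have -> : q = xbar by rewrite (graph_ptE Cq) qx -xbarE.
    exists G; first exact EG.
    by rewrite JGF; exact: planar_eigen_unit eig0F eig1F eigmuF lam_neq0 mu_neq0.
  have Dq : Delta D xbar q := increasing_graph_Delta phi_incr CD Cx Cq qx.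
  have [Gq EGq] := hCm q (or_intror Dq); exists Gq; first exact EGq.
  exact (hinv q Dq Gq (Ck_extension_le (ltn0Sn m) EGq)).
apply: (stable_germ_Ck nd1 nd2 TD hcomp Ind phiC CD TC cI Ef _ unitJ).
  by rewrite fc.
by rewrite -xbarE => q /Cbasin[].
Qed.
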